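(* Let $k$ be an algebraically closed field of characteristic $2$, let $q_0$ be a power of $2$, and let $q=2q_0^2$. Let $\tilde{\mathcal{S}}$ be the smooth model of the curve in $\mathbb{P}^3$ over $k$ defined (in affine coordinates $x,y,z$) by $$y^q+y=x^{q_0}(x^q+x) \quad\text{and}\quad x^q+x=z^{q-2q_0+1}.$$ Let $G_1, G_2 \subset \mathrm{Aut}(\tilde{\mathcal{S}})$ and $P_1,P_2 \in \tilde{\mathcal{S}}$ be the groups and points defined in the context. Then the $4$-tuple $(G_1,G_2,P_1,P_2)$ satisfies the conditions (a) $\tilde{\mathcal{S}}/G_1 \cong \mathbb{P}^1$ and $\tilde{\mathcal{S}}/G_2 \cong \mathbb{P}^1$; (b) $G_1 \cap G_2=\{1\}$; (c) $P_1+\sum_{\sigma \in G_1}\sigma(P_2)=P_2+\sum_{\tau \in G_2}\tau(P_1)$ as divisors on $\tilde{\mathcal{S}}$; that is, the curve $\tilde{\mathcal{S}}$ has a plane model of degree $q^2+1$ with two (different) inner Galois points.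
   Context: Definition of the groups and points. $P_1 \in \tilde{\mathcal{S}}$ is the (unique) pole of the function $x$. $G_1$ is the group of order $q^2$ of automorphisms of $\tilde{\mathcal{S}}$ given by $$(x,y,z)\mapsto (x+a,\ y+a^{q_0}x+b,\ z),\qquad a,b \in \mathbb{F}_q,$$ i.e. induced by the matrices $\begin{pmatrix}1&0&0&a\\ a^{q_0}&1&0&b\\ 0&0&1&0\\ 0&0&0&1\end{pmatrix}\in \mathrm{PGL}(4,k)$; it fixes $P_1$. Put $\alpha:=y^{2q_0}+x^{2q_0+1}$ and $\beta:=xy^{2q_0}+\alpha^{2q_0}$, and let $\xi$ be the automorphism of $\tilde{\mathcal{S}}$ given by $$\xi(x,y,z)=\left(\frac{\alpha}{\beta},\frac{y}{\beta},\frac{z}{\beta}\right).$$ Then $P_2:=\xi(P_1)=(0:0:0:1)$, i.e. the point with $x=y=z=0$, and $G_2:=\xi G_1\xi^{-1}$, which fixes $P_2$. Terminology. A plane model of a smooth projective curve $\mathcal{D}$ of degree $d$ is the image $\varphi(\mathcal{D})$, a plane curve of degree $d$, of a morphism $\varphi: \mathcal{D}\to\mathbb{P}^2$ that is birational onto its image. For a plane curve $C \subset \mathbb{P}^2$, a point $P \in \mathbb{P}^2$ is a Galois point for $C$ if the function field extension $k(C)/\pi_P^*k(\mathbb{P}^1)$ induced by the projection $\pi_P: C \dashrightarrow \mathbb{P}^1$ from $P$ is Galois. A Galois point $P$ is called inner if $P$ is a smooth point of $C$ (in particular $P \in C$). *)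

(* Defs.v *)
(* A smooth projective curve over the algebraically closed field k is handled
   through its function field K, a field with structure map
   iota : {rmorphism k -> K}: its points are the places of K/k, its
   automorphisms are the k-automorphisms of K (acting by pullback), its
   divisors are the elements of the free abelian group on its points. *)
From HB Require Import structures.
From mathcomp Require Import all_boot all_algebra fraction.
From mathcomp Require Import boolp classical_sets functions cardinality fsbigop.
From mathcomp Require Import mpoly freeg.

Set Implicit Arguments.
Unset Strict Implicit.
Unset Printing Implicit Defensive.

Import GRing.Theory.
Local Open Scope classical_set_scope.
Local Open Scope ring_scope.

Section FunctionField.
Context (k : closedFieldType) (K : fieldType) (iota : {rmorphism k -> K}).

Definition subextension (L : set K) : Prop :=
  divring_closed (mem L) /\ range iota `<=` L.

(* k(S) *)
Definition adjoin (S : set K) : set K := smallest subextension S.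

(* K is the fraction field of k[X_1,...,X_n]/I(C), the class of X_i being x_i *)
Definition is_function_field (n : nat) (C : set ('I_n -> k)) (x : 'I_n -> K)
  : Prop :=
  (forall p : {mpoly k[n]},
     (map_mpoly iota p).@[x] = 0 <-> (forall v, C v -> p.@[v] = 0))
  /\ adjoin (range x) = setT.

Definition is_valuation_ring (O : set K) : Prop :=
  [/\ subring_closed (mem O), range iota `<` O, O `<` setT
    & forall f, O f \/ O f^-1].

Record place := Place {
  regular_at :> set K;
  placeP : is_valuation_ring regular_at }.

HB.instance Definition _ := gen_eqMixin place.
HB.instance Definition _ := gen_choiceMixin place.

Definition has_pole (f : K) (P : place) : Prop := ~ regular_at P f.

Definition vanishes (f : K) (P : place) : Prop :=
  regular_at P f /\ (f = 0 \/ has_pole f^-1 P).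

Definition has_value (f : K) (P : place) (c : k) : Prop :=
  vanishes (f - iota c) P.

Definition point_divisor (P : place) : {freeg place} := << P >>.

(* pullback s f is the function "f composed with s" *)
Record curve_aut := CurveAut {
  pullback : K -> K;
  pullback_inv : K -> K;
  pullback_zmod : zmod_morphism pullback;
  pullback_monoid : monoid_morphism pullback;
  pullback_iota : forall c, pullback (iota c) = iota c;
  pullbackK : cancel pullback pullback_inv;
  pullback_invK : cancel pullback_inv pullback }.

HB.instance Definition _ := gen_eqMixin curve_aut.
HB.instance Definition _ := gen_choiceMixin curve_aut.

HB.instance Definition _ (s : curve_aut) :=
  GRing.isZmodMorphism.Build K K (pullback s) (pullback_zmod s).
HB.instance Definition _ (s : curve_aut) :=
  GRing.isMonoidMorphism.Build K K (pullback s) (pullback_monoid s).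

Lemma curve_aut_eq (s t : curve_aut) : pullback s =1 pullback t -> s = t.
Proof.
case: s t => [f f' fa fm fi fK f'K] [g g' ga gm gi gK g'K] /= /funext fg.
subst g.
have fg' : f' = g'.
  by apply/funext => a; rewrite -{2}(f'K a) gK.
by subst g'; f_equal; exact: Prop_irrelevance.
Qed.

Definition aut_one : curve_aut.
Proof.
refine (@CurveAut idfun idfun _ _ _ _ _) => //; exact: idfun_is_monoid_morphism.
Defined.

Definition aut_mul (s t : curve_aut) : curve_aut.
Proof.
refine (@CurveAut (pullback t \o pullback s) (pullback_inv s \o pullback_inv t)
  _ _ _ _ _).
- by move=> a b /=; rewrite !rmorphB.
- by split=> [|a b] /=; rewrite ?rmorph1 ?rmorphM.
- by move=> c /=; rewrite !pullback_iota.
- exact: can_comp (@pullbackK t) (@pullbackK s).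
- exact: can_comp (@pullback_invK s) (@pullback_invK t).
Defined.

Definition aut_inv (s : curve_aut) : curve_aut.
Proof.
refine (@CurveAut (pullback_inv s) (pullback s) _ _ _ _ _).
- exact: can2_zmod_morphism (@pullbackK s) (@pullback_invK s).
- exact: can2_monoid_morphism (@pullbackK s) (@pullback_invK s).
- by move=> c; rewrite -{1}(pullback_iota s c) pullbackK.
- exact: pullback_invK.
- exact: pullbackK.
Defined.

Fact aut_mulA : associative aut_mul.
Proof. by move=> s t u; apply: curve_aut_eq. Qed.
Fact aut_mul1 : left_id aut_one aut_mul.
Proof. by move=> s; apply: curve_aut_eq. Qed.
Fact aut_mulr1 : right_id aut_one aut_mul.
Proof. by move=> s; apply: curve_aut_eq. Qed.
Fact aut_mulV : left_inverse aut_one aut_inv aut_mul.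
Proof. by move=> s; apply: curve_aut_eq => f /=; rewrite pullback_invK. Qed.
Fact aut_mulrV : right_inverse aut_one aut_inv aut_mul.
Proof. by move=> s; apply: curve_aut_eq => f /=; rewrite pullbackK. Qed.

(* the group law is composition of automorphisms of the curve: (s * t)(P) =
   s (t P) *)
HB.instance Definition _ :=
  isGroup.Build curve_aut aut_mulA aut_mul1 aut_mulr1 aut_mulV aut_mulrV.

Fact aut_act_subproof (s : curve_aut) (P : place) :
  is_valuation_ring (pullback s @^-1` P).
Proof.
case: P => O /= [[O1 OB OM] [kO kO'] [_ OT] OV]; split.
- split=> [|a b|a b]; rewrite !inE /= ?rmorph1 ?rmorphB ?rmorphM => *.
  + by move: O1; rewrite inE.
  + by have := OB (pullback s a) (pullback s b); rewrite !inE; apply.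
  + by have := OM (pullback s a) (pullback s b); rewrite !inE; apply.
- split=> [_ [c _ <-] /=|sub]; first by rewrite pullback_iota; apply: kO; exists c.
  apply: kO' => f Of.
  have /sub[c _ cf] : (pullback s @^-1` O) (pullback_inv s f).
    by rewrite /= pullback_invK.
  by exists c => //; rewrite -(pullback_invK s f) -cf pullback_iota.
- split=> // sub; apply: OT => f _.
  by rewrite -(pullback_invK s f); exact: sub.
- by move=> f /=; rewrite fmorphV.
Qed.

(* f is regular at s P iff "f composed with s" is regular at P *)
Definition aut_act (s : curve_aut) (P : place) : place :=
  Place (aut_act_subproof s P).

(* the function field of the quotient curve by G *)
Definition invariants (G : set curve_aut) : set K :=
  [set f | forall s, G s -> pullback s f = f].

(* The quotient curve by G is isomorphic to P^1: its function field is
   k-isomorphic to k(T). *)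
Definition quotient_is_P1 (G : set curve_aut) : Prop :=
  exists phi : {rmorphism {fraction {poly k}} -> K},
    (forall c, phi (tofrac c%:P) = iota c) /\ range phi = invariants G.

(* points of P^2 are nonzero vectors up to scalars *)
Definition same_point (v w : 'I_3 -> k) : Prop :=
  exists2 c : k, c != 0 & forall i, w i = c * v i.

(* value at P of the morphism (f_0 : f_1 : f_2) from the curve to P^2 *)
Definition maps_to (f : 'I_3 -> K) (P : place) (v : 'I_3 -> k) : Prop :=
  (exists i, v i != 0) /\
  exists2 g : K, g != 0 & forall i, has_value (g * f i) P (v i).

Definition linear_form (w : 'I_3 -> k) (f : 'I_3 -> K) : K :=
  \sum_i iota (w i) * f i.

(* pi_v^* k(P^1), pi_v being the projection from v, seen in K via f *)
Definition projection_field (f : 'I_3 -> K) (v : 'I_3 -> k) : set K :=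
  adjoin [set h | exists w1 w2 : 'I_3 -> k,
    [/\ \sum_i w1 i * v i = 0, \sum_i w2 i * v i = 0
      & h = linear_form w1 f / linear_form w2 f]].

(* K/L is algebraic, and L is the fixed field of Aut(K/L) *)
Definition is_galois (L : set K) : Prop :=
  (forall h : K, exists p : {poly K},
     [/\ p != 0, forall i, L p`_i & root p h]) /\
  invariants [set s | forall l, L l -> pullback s l = l] = L.

End FunctionField.

Definition irreducible_mpoly (k : fieldType) (n : nat) (F : {mpoly k[n]})
  : Prop :=
  [/\ F != 0, F \isn't a GRing.unit
    & forall A B : {mpoly k[n]}, F = A * B ->
        A \is a GRing.unit \/ B \is a GRing.unit].

(* The morphism (f_0 : f_1 : f_2) is birational onto its image, which is the
   plane curve F = 0, of degree d. *)
Definition is_plane_model (k : closedFieldType) (K : fieldType)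
    (iota : {rmorphism k -> K}) (f : 'I_3 -> K) (F : {mpoly k[3]}) (d : nat)
  : Prop :=
  [/\ exists i, f i != 0,
      adjoin iota [set h | exists i j, h = f i / f j] = setT,
      irreducible_mpoly F, F \is d.-homog
    & forall v : 'I_3 -> k, (exists i, v i != 0) ->
        (F.@[v] = 0 <-> exists P : place iota, maps_to f P v)].

Definition smooth_point (k : fieldType) (F : {mpoly k[3]}) (v : 'I_3 -> k)
  : Prop :=
  [/\ exists i, v i != 0, F.@[v] = 0 & exists i, (mderiv i F).@[v] != 0].

Definition inner_galois_point (k : closedFieldType) (K : fieldType)
    (iota : {rmorphism k -> K}) (f : 'I_3 -> K) (F : {mpoly k[3]})
    (v : 'I_3 -> k) : Prop :=
  smooth_point F v /\ is_galois iota (projection_field iota f v).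

(* The smooth model depends only on this affine part of the curve in P^3. *)
Definition affine_curve (k : closedFieldType) (q0 : nat)
  : set ('I_3 -> k) :=
  let q := (2 * q0 ^ 2)%N in
  [set v | exists x y z : k,
    [/\ v = tnth [tuple x; y; z],
        y ^+ q + y = x ^+ q0 * (x ^+ q + x)
      & x ^+ q + x = z ^+ (q - 2 * q0 + 1)]].

Definition group_G1 (k : closedFieldType) (K : fieldType)
    (iota : {rmorphism k -> K}) (q0 : nat) (x y z : K)
  : set (curve_aut iota) :=
  let q := (2 * q0 ^ 2)%N in
  [set s | exists a b : k,
    [/\ a ^+ q = a /\ b ^+ q = b,
        pullback s x = x + iota a,
        pullback s y = y + iota (a ^+ q0) * x + iota b
      & pullback s z = z]].
Arguments group_G1 {k K} iota q0 x y z.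

Definition alpha (K : fieldType) (q0 : nat) (x y : K) : K :=
  y ^+ (2 * q0) + x ^+ (2 * q0 + 1).

Definition beta (K : fieldType) (q0 : nat) (x y : K) : K :=
  x * y ^+ (2 * q0) + alpha q0 x y ^+ (2 * q0).

Definition is_xi (k : closedFieldType) (K : fieldType)
    (iota : {rmorphism k -> K}) (q0 : nat) (x y z : K) (s : curve_aut iota)
  : Prop :=
  [/\ pullback s x = alpha q0 x y / beta q0 x y,
      pullback s y = y / beta q0 x y
    & pullback s z = z / beta q0 x y].

(* Main.v *)
Require Import Defs.
From HB Require Import structures.
From mathcomp Require Import all_boot all_algebra fraction.
From mathcomp Require Import separable.
From mathcomp Require Import boolp classical_sets functions cardinality fsbigop.
From mathcomp Require Import mpoly freeg.
From mathcomp Require Import ring zify.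

(** Write [m = q - 2 q0 + 1], so that the curve is [y ^ q + y = x ^ q0 (x ^ q + x)],
    [x ^ q + x = z ^ m].

    The field and its automorphisms. The equations are monic in [y] and in [x],
    and every fibre of [z] has [q ^ 2] points, so [k[x, y, z]] is free over [k[z]]
    on the [x ^ i y ^ l] with [i, l < q], and the two equations generate all
    relations ([ev_ker]). Hence every solution of the equations in [K] is a
    specialisation of the generic point. This yields the translations
    ([translation_exists]) and [xi] ([xi_exists]); that the coordinates of [xi]
    solve the equations is an identity between Frobenius powers. An element of
    [k[x, y, z]] fixed by the [q ^ 2] translations is constant in [x] and [y], so
    the field of [G1] is [k(z)] ([range_invariant], [invariant_G1]) and the field
    of [G2 = xi G1 xi] is [k(z / beta)].

    The places. At an affine point [(a, b, c)] the local ring is a valuation ring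
    with uniformiser [z - c], since [x - a] and [y - b] are multiples of it, and
    the order of an element is bounded by that of its norm to [k(z)]
    ([local_ring_valuation]). The origin gives [P2], and [P1 = xi P2]. Near a pole
    of [x] the dominant terms of the equations force a pole of [beta]; as [xi] maps
    [beta] to its inverse, [xi] sends a pole of [x] to an affine zero of [beta], and
    the only one is the origin. So [P1] is the only pole of [x] ([pole_x]).

    The conditions on the two groups. An automorphism in both groups fixes [P2], but
    [G1] acts freely on the orbit of [P2], which consists of the points [(a, b, 0)]
    with [a ^ q = a] and [b ^ q = b]. Together with [P1] they form a set stable
    under [xi], so both divisors are the sum of its points ([divisor_eq]).

    The plane model is [(1 : beta : z)]. These functions generate [K], because [x]
    and [y] can be recovered by Frobenius ([x_of_beta_z]). The minimal polynomial of
    [beta] over [k(z)] is the product of the [T - s beta] for [s] in [G1]. At [P1]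
    the functions [beta ^ (q ^ 2)] and [z ^ (q ^ 2 + 1)] have the same leading
    term, which bounds the degrees of its coefficients ([size_c], [size_c0],
    [c0_lead]): it is the affine equation of a curve [F = 0] of degree [q ^ 2 + 1]
    that meets the line at infinity at [(0 : 1 : 0)] only. [F] is irreducible
    because the conjugates of [beta] are distinct ([chi_beta_irreducible],
    [homogenization_irreducible]). The coefficients of [X Y ^ (q ^ 2)] and of
    [X ^ (q ^ 2) Y] do not vanish, so [(0 : 1 : 0)] and [(1 : 0 : 0)] are smooth
    points; the projections from them are [z] and [z / beta], whose fields are
    fixed fields of [G1] and [G2]. *)

Set Implicit Arguments.
Unset Strict Implicit.
Unset Printing Implicit Defensive.
Import GRing.Theory.
Local Open Scope classical_set_scope.
Local Open Scope card_scope.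
Local Open Scope ring_scope.

(** * Rings and fields *)

(** Two maps to fields with the same kernel extend to each other's fractions. With
    [R] a polynomial ring this yields the endomorphisms of a function field, and
    with [R = k[T]] the embeddings of [k(T)]. *)
Lemma fraction_extension (R : comNzRingType) (E K : fieldType)
    (i : {rmorphism R -> E}) (j : {rmorphism R -> K}) :
    (forall h, exists a b, i b != 0 /\ h = i a / i b) ->
    (forall a, (j a == 0) = (i a == 0)) ->
  exists phi : {rmorphism E -> K}, forall a, phi (i a) = j a.
Proof.
move=> frac ker.
have ex h : {ab | i ab.2 != 0 /\ h = i ab.1 / i ab.2}.
  by apply: cid; have [a [b ?]] := frac h; exists (a, b).
pose phi h := j (sval (ex h)).1 / j (sval (ex h)).2.
have phiE a b : i b != 0 -> phi (i a / i b) = j a / j b.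
  move=> b0; rewrite /phi; case: (ex _) => -[c d] /= [d0 E1].
  apply/eqP; rewrite eqr_div ?ker // -!rmorphM -subr_eq0 -rmorphB ker.
  by rewrite rmorphB !rmorphM subr_eq0 -eqr_div // E1.
have iE a : i a = i a / i 1 by rewrite rmorph1 divr1.
have phiB : zmod_morphism phi.
  move=> g h; have [a [b [b0 ->]]] := frac g; have [c [d [d0 ->]]] := frac h.
  rewrite -mulNr addf_div // mulNr -!rmorphM -rmorphB !phiE ?rmorphM ?mulf_neq0 //.
  by rewrite rmorphB !rmorphM -[in RHS]mulNr addf_div ?ker // mulNr.
have phiM : monoid_morphism phi.
  split=> [|g h].
    by rewrite -(rmorph1 i) iE phiE ?rmorph1 ?oner_eq0 ?divr1.
  have [a [b [b0 ->]]] := frac g; have [c [d [d0 ->]]] := frac h.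
  by rewrite mulf_div -!rmorphM !phiE ?rmorphM ?mulf_neq0 // mulf_div.
pose phiB' := GRing.isZmodMorphism.Build _ _ _ phiB.
pose phiM' := GRing.isMonoidMorphism.Build _ _ _ phiM.
pose f : {rmorphism E -> K} := HB.pack phi phiB' phiM'.
by exists f => a; rewrite [i a]iE [LHS]phiE ?rmorph1 ?oner_eq0 ?divr1.
Qed.

Lemma fraction_quotient (R : idomainType) (h : {fraction R}) :
  exists a b : R, tofrac b != 0 /\ h = tofrac a / tofrac b.
Proof.
elim/quotW: h => r; exists \n_r, \d_r; rewrite tofrac_eq0 denom_ratioP; split=> //.
unlock tofrac; rewrite -[X in _ = _ * X]FracField.pi_inv -[RHS]FracField.pi_mul.
rewrite /FracField.mulf /FracField.invf !numden_Ratio ?oner_neq0 ?denom_ratioP //.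
by rewrite mulr1 mul1r Ratio_numden.
Qed.

(** [X] is prime, so the factors [X] of the product can be distributed one at a time. *)
Lemma monomial_factor (R : idomainType) (p p' : {poly R}) (c : R) n :
  c != 0 -> p * p' = c%:P * 'X^n -> exists a i, p = a%:P * 'X^i.
Proof.
move=> c0; have Xr := mulIf (negbT (polyX_eq0 R)).
have divX (r : {poly R}) : r.[0] = 0 -> exists r', r = r' * 'X.
  by move/eqP/factor_theorem => [r' ->]; exists r'; rewrite subr0.
elim: n p p' => [|n IH] p p'; rewrite ?exprSr ?mulrA => E1.
  have : size (p * p') = 1%N by rewrite E1 mulr1 size_polyC c0.
  move=> sz; have p0 : p != 0 by apply/eqP => p0; move: sz; rewrite p0 mul0r size_poly0.
  have p'0 : p' != 0 by apply/eqP => p'0; move: sz; rewrite p'0 mulr0 size_poly0.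
  have /size_poly1P[a _ ->] : size p == 1%N.
    move: sz p0 p'0; rewrite -!size_poly_gt0 => + A B; rewrite size_mul -?size_poly_gt0 //; lia.
  by exists a, 0%N; rewrite mulr1.
have /eqP : p.[0] * p'.[0] = 0 by rewrite -hornerM E1 hornerMX mulr0.
rewrite mulf_eq0 => /orP[] /eqP /divX[r rE]; move: E1; rewrite rE.
  rewrite mulrAC => /Xr/IH[a [i ->]]; exists a, i.+1.
  by rewrite exprSr mulrA.
by rewrite mulrA => /Xr/IH.
Qed.

Section CharTwo.
Context (R : comNzRingType) (R2 : 2%N \in [pchar R]).

Lemma exp2nD n (a b : R) : (a + b) ^+ (2 ^ n) = a ^+ (2 ^ n) + b ^+ (2 ^ n).
Proof.
by apply: exprDn_pchar; rewrite pnatX (eq_pnat _ (pcharf_eq R2)) pnat_id.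
Qed.

(** Reduces an identity modulo two to an identity over the integers, with an
    explicit correction [c]. *)
Lemma eq_pchar2 (c a b : R) : a = b + 2%:R * c -> a = b.
Proof. by move=> ->; rewrite (pcharf0 R2) mul0r addr0. Qed.

End CharTwo.

(** * The affine curve over a field of characteristic two *)

Section Equations.
Context (n : nat).
Local Notation q0 := (2 ^ n)%N.
Local Notation q := (2 * q0 ^ 2)%N.
Local Notation m := (q - 2 * q0 + 1)%N.

Lemma q_pow2 : q = (2 ^ (n + n).+1)%N.
Proof. by rewrite -expnM muln2 -addnn -expnS. Qed.

Lemma q0_gt0 : (0 < q0)%N. Proof. by rewrite expn_gt0. Qed.

Lemma q_gt1 : (1 < q)%N.
Proof.
have : (0 < q0 ^ 2)%N by rewrite expn_gt0 q0_gt0.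
by lia.
Qed.

Lemma q0_le_sqr : (q0 <= q0 ^ 2)%N.
Proof. by rewrite -mulnn leq_pmulr ?q0_gt0. Qed.

Lemma mD : (m + 2 * q0 = q + 1)%N.
Proof. by have := q0_le_sqr; lia. Qed.

Lemma m_gt0 : (0 < m)%N. Proof. by rewrite addn1. Qed.

Lemma mM : (m * (q + 2 * q0 + 1) = q ^ 2 + 1)%N.
Proof.
have := q0_le_sqr; rewrite -!mulnn; move: q0 => r r_le.
have [M ME] : exists M, (2 * (r * r) = M + 2 * r)%N.
  by exists (2 * (r * r) - 2 * r)%N; lia.
rewrite ME addnK.
have -> : ((M + 2 * r) * (M + 2 * r) = M * M + 4 * r * M + 2 * (2 * (r * r)))%N by ring.
by rewrite ME; ring.
Qed.

Definition on_curve (L : fieldType) (x y z : L) : Prop :=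
  y ^+ q + y = x ^+ q0 * (x ^+ q + x) /\ x ^+ q + x = z ^+ m.

Section Identities.
Context (L : fieldType) (L2 : 2%N \in [pchar L]) (x y z : L).
Context (xyz : on_curve x y z).
Local Notation X := (x ^+ q0).
Local Notation Y := (y ^+ q0).
Local Notation t := (z ^+ m).
Local Notation alpha := (alpha q0 x y).
Local Notation beta := (beta q0 x y).

Lemma expqD (a b : L) : (a + b) ^+ q = a ^+ q + b ^+ q.
Proof. by rewrite q_pow2 exp2nD. Qed.

Lemma exp2q0D (a b : L) : (a + b) ^+ (2 * q0) = a ^+ (2 * q0) + b ^+ (2 * q0).
Proof. by rewrite -expnS exp2nD. Qed.

Lemma exprq0K (a : L) : (a ^+ q0) ^+ (2 * q0) = a ^+ q.
Proof. by rewrite -exprM mulnCA. Qed.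

Lemma expr2q0 (a : L) : a ^+ (2 * q0) = (a ^+ q0) ^+ 2.
Proof. by rewrite mulnC exprM. Qed.

Lemma xq : x ^+ q = x + t.
Proof. by case: xyz => _ <-; apply: (eq_pchar2 L2 (c := - x)); ring. Qed.

Lemma yq : y ^+ q = y + X * t.
Proof. by case: xyz => E1 <-; rewrite -E1; apply: (eq_pchar2 L2 (c := - y)); ring. Qed.

(** Since [X ^ (2 q0) = x + t] and [Y ^ (2 q0) = y + X t], Frobenius powers of
    [alpha] and [beta] are polynomials in [x], [y], [X], [Y] and [t], and the
    identities needed for [xi] become polynomial identities modulo two. *)
Lemma alphaE : alpha = Y ^+ 2 + X ^+ 2 * x.
Proof. by rewrite /Defs.alpha exprD expr1 !expr2q0. Qed.

Lemma alpha_q0 : alpha ^+ q0 = y + X * x.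
Proof.
rewrite /Defs.alpha exp2nD // -!exprM mulnDl mul1n.
rewrite -[(2 * q0 * q0)%N]mulnA exprD yq xq; apply: (eq_pchar2 L2 (c := X * t)); ring.
Qed.

Lemma betaE : beta = x * Y ^+ 2 + y ^+ 2 + X ^+ 2 * x ^+ 2.
Proof.
rewrite /Defs.beta !expr2q0 alpha_q0.
by apply: (eq_pchar2 L2 (c := y * X * x)); ring.
Qed.

Lemma alpha_q : alpha ^+ q = alpha + t * X ^+ 2.
Proof.
rewrite -exprq0K alpha_q0 exp2q0D exprMn exprq0K xq !expr2q0 alphaE.
by ring.
Qed.

Lemma beta_q0 : beta ^+ q0 = alpha + X * y.
Proof.
rewrite /Defs.beta exp2nD // exprMn -!exprM -[(2 * q0 * q0)%N]mulnA alpha_q yq.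
by apply: (eq_pchar2 L2 (c := X ^+ 2 * t)); ring.
Qed.

Lemma beta_q : beta ^+ q = beta + t * Y ^+ 2.
Proof.
have sq (a b : L) : (a + b) ^+ 2 = a ^+ 2 + b ^+ 2.
  by apply: (eq_pchar2 L2 (c := a * b)); ring.
have ex (a : L) : (a ^+ 2) ^+ q0 = (a ^+ q0) ^+ 2 by rewrite exprAC.
rewrite -(exprq0K beta) exprAC expr2q0 beta_q0 sq exp2nD // !ex alpha_q0.
rewrite 2!exprMn -(expr2q0 X) exprq0K xq !sq betaE exprMn.
by ring.
Qed.

(** Both sides are the same polynomial in [x], [y] and their [q0]-th powers;
    it says that [xi] maps [alpha] to [x / beta]. *)
Lemma x_beta_2q0 :
  Y ^+ 2 * beta + (y + X * x) ^+ 2 * alpha = x * (alpha + X * y) ^+ 2.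
Proof.
rewrite betaE alphaE.
by apply: (eq_pchar2 L2 (c := Y ^+ 2 * y ^+ 2)); ring.
Qed.

(** The numerator of [x ^ q + x] after applying [xi], up to the factor [t]. *)
Lemma beta_2q0 : x ^+ (2 * q0) * beta + alpha * y ^+ (2 * q0) = beta ^+ (2 * q0).
Proof.
rewrite !expr2q0 beta_q0 betaE alphaE.
apply/esym/(eq_pchar2 L2 (c := X ^+ 3 * x * y + X * Y ^+ 2 * y)); ring.
Qed.

(** The numerator of [y ^ q + y] after applying [xi], up to the factor [t]. *)
Lemma xi_curve_identity : X * beta + y * Y ^+ 2 = (y + X * x) * (alpha + X * y).
Proof.
rewrite betaE alphaE.
by apply/esym/(eq_pchar2 L2 (c := X ^+ 2 * x * y)); ring.
Qed.

(** If [beta = 0], then [x_beta_2q0] and [alpha_q0] give [alpha = 0], [beta_q0]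
    gives [x ^ q0 y = 0], and [alpha_q0] once more gives [x = y = 0]. *)
Lemma beta_eq0 : beta = 0 -> [/\ x = 0, y = 0 & z = 0].
Proof.
move=> b0; have := x_beta_2q0; have := beta_q0.
rewrite b0 expr0n -[q0 == 0%N]negbK -lt0n q0_gt0 /= => <-; rewrite mulr0 expr0n mulr0 add0r.
move/eqP; rewrite mulf_eq0 expf_eq0 /= -alpha_q0 expf_eq0 q0_gt0 /= orbb => /eqP a0.
have := alpha_q0; have := beta_q0.
rewrite a0 b0 add0r !expr0n -[q0 == 0%N]negbK -lt0n q0_gt0 /= => /esym/eqP.
rewrite mulf_eq0 expf_eq0 q0_gt0 /= => xy0 yE.
have x0 : x = 0.
  case/orP: xy0 => /eqP // y0; move/esym/eqP: yE.
  by rewrite y0 add0r mulf_eq0 expf_eq0 q0_gt0 /= orbb => /eqP.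
have y0 : y = 0 by move: yE; rewrite x0 mulr0 addr0.
split=> //; have /esym/eqP := xyz.2.
by rewrite x0 addr0 expr0n gtn_eqF ?(ltnW q_gt1) // expf_eq0 m_gt0 => /eqP.
Qed.

Section Xi.
Context (beta0 : beta != 0).

Lemma alpha_q0_div : (alpha / beta) ^+ q0 = (y + X * x) / (alpha + X * y).
Proof. by rewrite expr_div_n alpha_q0 beta_q0. Qed.

Lemma xi_on_curve : on_curve (alpha / beta) (y / beta) (z / beta).
Proof.
have bq0 : alpha + X * y != 0 by rewrite -beta_q0 expf_neq0.
have bq1 : beta + t * Y ^+ 2 != 0 by rewrite -beta_q expf_neq0.
have x'E : (alpha / beta) ^+ q + alpha / beta
    = t * beta ^+ (2 * q0) / (beta * (beta + t * Y ^+ 2)).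
  rewrite expr_div_n alpha_q beta_q -beta_2q0 !expr2q0.
  rewrite addf_div // [(_ + t * _) * beta in X in _ / X]mulrC; congr (_ / _).
  by apply: (eq_pchar2 L2 (c := alpha * beta)); ring.
split.
  rewrite x'E alpha_q0_div expr_div_n yq beta_q expr2q0 beta_q0.
  have -> : (y + X * x) / (alpha + X * y)
       * (t * (alpha + X * y) ^+ 2 / (beta * (beta + t * Y ^+ 2)))
     = t * ((y + X * x) * (alpha + X * y)) / (beta * (beta + t * Y ^+ 2)).
    by field; rewrite bq0 bq1 beta0.
  rewrite -xi_curve_identity addf_div // [(_ + t * _) * beta in X in _ / X]mulrC.
  congr (_ / _).
  by apply: (eq_pchar2 L2 (c := y * beta)); ring.
rewrite x'E -beta_q -exprS expr_div_n; apply/eqP.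
rewrite eqr_div ?expf_neq0 // -mulrA -exprD.
by rewrite [(2 * q0 + m)%N]addnC mD (addn1 q).
Qed.

Lemma alpha_xi : Defs.alpha q0 (alpha / beta) (y / beta) = x / beta.
Proof.
have bq0 : alpha + X * y != 0 by rewrite -beta_q0 expf_neq0.
rewrite {1}/Defs.alpha exprD expr1 !expr2q0 alpha_q0_div !expr_div_n beta_q0.
transitivity (x * (alpha + X * y) ^+ 2 / ((alpha + X * y) ^+ 2 * beta)).
  by rewrite -x_beta_2q0; field; rewrite bq0 beta0.
by field; rewrite bq0 beta0.
Qed.

Lemma beta_xi : Defs.beta q0 (alpha / beta) (y / beta) = beta^-1.
Proof.
have bq0 : beta ^+ (2 * q0) != 0 by rewrite expf_neq0.
rewrite {1}/Defs.beta alpha_xi !expr_div_n.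
transitivity (beta ^+ (2 * q0) / (beta * beta ^+ (2 * q0))).
  by rewrite -[X in _ = X / _]beta_2q0; field; rewrite bq0 beta0.
by rewrite invfM mulrCA divff ?mulr1.
Qed.

End Xi.

(** [beta] and [z] generate the function field: [y ^ (2 q0)] is
    [(beta ^ q + beta) / z ^ m], and [x] and [y] come back from it through
    Frobenius. *)
Lemma x_of_beta_z (w := (beta ^+ q + beta) / t) : z != 0 ->
  x = (w ^+ q + w) / t ^+ (2 * q0) + t.
Proof.
move=> z0; have t0 : t != 0 by rewrite expf_neq0.
have -> : w = Y ^+ 2.
  rewrite /w beta_q; apply: (canLR (mulfK t0)).
  by apply: (eq_pchar2 L2 (c := beta)); ring.
have -> : (Y ^+ 2) ^+ q = Y ^+ 2 + (x + t) * t ^+ (2 * q0).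
  by rewrite -expr2q0 -exprM mulnC exprM yq exp2q0D exprMn exprq0K xq.
rewrite addrAC (_ : Y ^+ 2 + Y ^+ 2 = 0) ?add0r ?mulfK ?expf_neq0 //.
  by apply: (eq_pchar2 L2 (c := - t)); ring.
by rewrite addrr_pchar2.
Qed.

Lemma y_of_beta_z (w := (beta ^+ q + beta) / t) : z != 0 ->
  y = w ^+ q0 + X * t.
Proof.
move=> z0; have t0 : t != 0 by rewrite expf_neq0.
have -> : w = Y ^+ 2.
  rewrite /w beta_q; apply: (canLR (mulfK t0)).
  by apply: (eq_pchar2 L2 (c := beta)); ring.
rewrite exprAC -expr2q0 exprq0K yq.
by apply: (eq_pchar2 L2 (c := - (X * t))); ring.
Qed.

End Identities.
End Equations.

Section Points.
Context (n : nat).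
Local Notation q0 := (2 ^ n)%N.
Local Notation q := (2 * q0 ^ 2)%N.
Local Notation m := (q - 2 * q0 + 1)%N.

Lemma translate_on_curve (L : fieldType) (L2 : 2%N \in [pchar L])
    (a b x y z : L) :
  a ^+ q = a -> b ^+ q = b -> on_curve n x y z ->
  on_curve n (x + a) (y + a ^+ q0 * x + b) z.
Proof.
move=> aq bq [yE xE]; split; last first.
  by rewrite -xE expqD // aq; apply: (eq_pchar2 L2 (c := a)); ring.
rewrite !expqD // bq aq exprMn exprAC aq exp2nD //.
have -> : y ^+ q = x ^+ q0 * (x ^+ q + x) + y.
  by rewrite -yE; apply: (eq_pchar2 L2 (c := - y)); ring.
apply: (eq_pchar2 L2 (c := y + b - a * x ^+ q0 - a * a ^+ q0)); ring.
Qed.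

Section Closed.
Context (k : closedFieldType) (k2 : 2%N \in [pchar k]).

(** The derivative of [X ^ q - X] is [-1], so its roots are simple. *)
Lemma Fq_enum : exists e : 'I_q -> k,
  injective e /\ forall a, a ^+ q = a <-> exists i, a = e i.
Proof.
pose p : {poly k} := 'X^q - 'X.
have sp : size p = q.+1.
  by rewrite size_polyDl size_polyXn // size_polyN size_polyX ltnS q_gt1.
have [r rE] := closed_field_poly_normal p.
have lc : lead_coef p = 1.
  by rewrite lead_coefDl ?lead_coefXn // size_polyXn size_polyN size_polyX ltnS q_gt1.
rewrite lc scale1r in rE.
have sr : size r = q.
  by apply/succn_inj; rewrite -sp rE size_prod_XsubC.
have ur : uniq r.
  rewrite -separable_prod_XsubC -rE unlock /p derivB derivXn derivX.
  rewrite -scaler_nat natrM (pcharf0 k2) mul0r scale0r sub0r.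
  by rewrite -(scaleN1r (1 : {poly k})) coprimepZr ?coprimep1 // oppr_eq0 oner_eq0.
have mem_r a : (a \in r) = (a ^+ q == a).
  by rewrite -root_prod_XsubC -rE /root /p !hornerE subr_eq0.
exists (fun i => r`_i); split=> [i j /eqP|a].
  by rewrite nth_uniq ?sr // => /eqP/val_inj.
split=> [/eqP|[i ->]]; last by apply/eqP; rewrite -mem_r mem_nth ?sr.
rewrite -mem_r => ar; have ia : (index a r < q)%N by rewrite -sr index_mem.
by exists (Ordinal ia); rewrite nth_index.
Qed.

Lemma exists_expq_addr (c : k) : exists x, x ^+ q + x = c.
Proof.
pose p : {poly k} := 'X^q + ('X - c%:P).
have sp : size p = q.+1.
  by rewrite size_polyDl size_polyXn // size_XsubC ltnS q_gt1.
have /closed_rootP[x] : size p != 1%N by rewrite sp eqSS -lt0n ltnW ?q_gt1.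
by rewrite /root /p !hornerE ?addrA subr_eq0 => /eqP; exists x.
Qed.

Lemma exists_on_curve (c : k) : exists x y, on_curve n x y c.
Proof.
have [x xE] := exists_expq_addr (c ^+ m).
have [y yE] := exists_expq_addr (x ^+ q0 * (x ^+ q + x)).
by exists x, y.
Qed.

End Closed.
End Points.

(** * Places *)

Section Places.
Context (k : closedFieldType) (K : fieldType) (iota : {rmorphism k -> K}).
Implicit Types (P : place iota) (f g : K) (c d : k).

Lemma place_eq P P' : regular_at P = regular_at P' -> P = P'.
Proof.
by case: P P' => [O p] [O' p'] /= E1; subst O'; f_equal; exact: Prop_irrelevance.
Qed.

Section OnePlace.
Context (P : place iota).

Lemma regular_iota c : regular_at P (iota c).
Proof. by case: (placeP P) => _ [+ _] _ _; apply; exists c. Qed.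

Lemma regular1 : regular_at P 1.
Proof. by rewrite -(rmorph1 iota); exact: regular_iota. Qed.

Lemma regular0 : regular_at P 0.
Proof. by rewrite -(rmorph0 iota); exact: regular_iota. Qed.

Lemma regularB f g : regular_at P f -> regular_at P g -> regular_at P (f - g).
Proof.
by case: (placeP P) => -[_ OB _] _ _ _ Of Og; have := OB f g; rewrite !inE; apply.
Qed.

Lemma regularN f : regular_at P f -> regular_at P (- f).
Proof. by rewrite -[- f]add0r => /(regularB regular0). Qed.

Lemma regularD f g : regular_at P f -> regular_at P g -> regular_at P (f + g).
Proof. by rewrite -[g in f + g]opprK => Of /regularN /(regularB Of). Qed.

Lemma regularM f g : regular_at P f -> regular_at P g -> regular_at P (f * g).
Proof.
by case: (placeP P) => -[_ _ OM] _ _ _ Of Og; have := OM f g; rewrite !inE; apply.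
Qed.

Lemma regularX f i : regular_at P f -> regular_at P (f ^+ i).
Proof.
by move=> Of; elim: i => [|i IH]; [exact: regular1|rewrite exprS; exact: regularM].
Qed.

Lemma regular_or_inv f : regular_at P f \/ regular_at P f^-1.
Proof. by case: (placeP P). Qed.

Lemma vanishes0 : vanishes 0 P.
Proof. by split; [exact: regular0 | left]. Qed.

Lemma vanishes_regular f : vanishes f P -> regular_at P f.
Proof. by case. Qed.

Lemma pole_neq0 f : has_pole f P -> f != 0.
Proof. by move=> pf; apply: contra_notN pf => /eqP ->; exact: regular0. Qed.

Lemma poleV f : has_pole f P -> vanishes f^-1 P.
Proof.
move=> pf; split; last by right; rewrite invrK.
by case: (regular_or_inv f).
Qed.

Lemma vanishesV f : regular_at P f -> ~ regular_at P f^-1 -> vanishes f P.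
Proof. by move=> Of Of'; split=> //; right. Qed.

Lemma vanishesMl f g : regular_at P f -> vanishes g P -> vanishes (f * g) P.
Proof.
move=> Of [Og g0]; split; first exact: regularM.
have [->|fN0] := eqVneq f 0; first by left; rewrite mul0r.
case: g0 => [->|pg]; [by left; rewrite mulr0|right].
move=> Ofg; apply: pg; have -> : g^-1 = f * (f * g)^-1.
  by rewrite invfM mulrA divff // mul1r.
exact: regularM.
Qed.

Lemma vanishesMr f g : vanishes f P -> regular_at P g -> vanishes (f * g) P.
Proof. by rewrite mulrC => vf Og; exact: vanishesMl. Qed.

(** A non-zero [f + g] is [f * (1 + g / f)] or [g * (1 + f / g)], with one of
    the quotients regular. *)
Lemma vanishesD f g : vanishes f P -> vanishes g P -> vanishes (f + g) P.
Proof.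
have [->|f0] := eqVneq f 0; first by rewrite add0r.
have [->|g0] := eqVneq g 0; first by rewrite addr0.
move=> vf vg; have [Ofg|] := regular_or_inv (f / g).
  have -> : f + g = (f / g + 1) * g by rewrite mulrDl mul1r divfK.
  by apply: vanishesMl => //; apply: regularD => //; exact: regular1.
rewrite invf_div => Ogf; have -> : f + g = (g / f + 1) * f.
  by rewrite mulrDl mul1r divfK // addrC.
by apply: vanishesMl => //; apply: regularD => //; exact: regular1.
Qed.

Lemma vanishesN f : vanishes f P -> vanishes (- f) P.
Proof.
by rewrite -mulN1r; apply: vanishesMl; apply: regularN; exact: regular1.
Qed.

Lemma vanishesB f g : vanishes f P -> vanishes g P -> vanishes (f - g) P.
Proof. by move=> vf /vanishesN; exact: vanishesD. Qed.

Lemma not_vanishes1 : ~ vanishes 1 P.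
Proof.
case=> _ [/eqP|]; first by rewrite oner_eq0.
by rewrite /has_pole invr1; apply; exact: regular1.
Qed.

Lemma vanishes_inv f : f != 0 -> vanishes f P -> ~ regular_at P f^-1.
Proof. by move=> f0 [_ []] // /eqP; rewrite (negPf f0). Qed.

Lemma regular_unit f : regular_at P f -> ~ vanishes f P -> regular_at P f^-1.
Proof. by move=> Of vf; apply: contra_notP vf => /(vanishesV Of). Qed.

Lemma vanishes_prime f g : regular_at P f -> regular_at P g ->
  vanishes (f * g) P -> vanishes f P \/ vanishes g P.
Proof.
move=> Of Og vfg; have [|vf] := pselect (vanishes f P); first by left.
have [|vg] := pselect (vanishes g P); first by right.
exfalso; have := vanishesMl (regularM (regular_unit Of vf) (regular_unit Og vg)) vfg.
have f0 : f != 0 by apply: contra_notN vf => /eqP ->; exact: vanishes0.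
have g0 : g != 0 by apply: contra_notN vg => /eqP ->; exact: vanishes0.
by rewrite -invfM mulVf ?mulf_neq0 //; exact: not_vanishes1.
Qed.

Lemma vanishes_expI f i : regular_at P f -> vanishes (f ^+ i) P -> vanishes f P.
Proof.
move=> Of; elim: i => [/not_vanishes1//|i IH]; rewrite exprS.
by case/vanishes_prime => //; exact: regularX.
Qed.

Lemma vanishesX f i : (0 < i)%N -> vanishes f P -> vanishes (f ^+ i) P.
Proof.
case: i => // i _ vf; rewrite exprS; apply: vanishesMr => //; apply: regularX.
exact: vanishes_regular.
Qed.

(** Valuation rings are integrally closed; this is the case of a radical. *)
Lemma regular_expI f i : (0 < i)%N -> regular_at P (f ^+ i) -> regular_at P f.
Proof.
move=> i0 Ofi; apply: contrapT => pf; have := vanishesX i0 (poleV pf).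
have f0 := pole_neq0 pf.
by move=> /vanishes_inv; rewrite exprVn invrK; apply=> //; rewrite invr_eq0 expf_neq0.
Qed.

Lemma iota_unit c : vanishes (iota c) P -> c = 0.
Proof.
move=> vc; apply/eqP/negP => /negP c0; apply: (@vanishes_inv (iota c)) => //.
  by rewrite fmorph_eq0.
by rewrite -fmorphV; exact: regular_iota.
Qed.

Lemma value_regular f c : has_value f P c -> regular_at P f.
Proof.
move=> [Of _]; rewrite -[f](subrK (iota c)); apply: regularD => //.
exact: regular_iota.
Qed.

Lemma value_iota c : has_value (iota c) P c.
Proof. by rewrite /has_value subrr; exact: vanishes0. Qed.

Lemma value0 f : has_value f P 0 <-> vanishes f P.
Proof. by rewrite /has_value rmorph0 subr0. Qed.

Lemma value1 : has_value 1 P 1.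
Proof. by rewrite -(rmorph1 iota); exact: value_iota. Qed.

Lemma value_uniq f c d : has_value f P c -> has_value f P d -> c = d.
Proof.
move=> vc vd; have := vanishesB vd vc; rewrite opprB addrC addrA subrK -rmorphB.
by move/iota_unit/eqP; rewrite subr_eq0 => /eqP.
Qed.

Lemma valueD f g c d : has_value f P c -> has_value g P d ->
  has_value (f + g) P (c + d).
Proof.
by move=> vf vg; rewrite /has_value rmorphD opprD addrACA; exact: vanishesD.
Qed.

Lemma valueB f g c d : has_value f P c -> has_value g P d ->
  has_value (f - g) P (c - d).
Proof.
move=> vf vg; have := vanishesB vf vg; rewrite /has_value rmorphB.
by rewrite !opprD !opprK addrACA.
Qed.

Lemma valueM f g c d : has_value f P c -> has_value g P d ->
  has_value (f * g) P (c * d).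
Proof.
move=> vf vg; rewrite /has_value.
have -> : f * g - iota (c * d) = f * (g - iota d) + (f - iota c) * iota d.
  by rewrite rmorphM mulrBr mulrBl addrA subrK.
apply: vanishesD; first by apply: vanishesMl => //; exact: value_regular vf.
by apply: vanishesMr => //; exact: regular_iota.
Qed.

Lemma valueX f c i : has_value f P c -> has_value (f ^+ i) P (c ^+ i).
Proof.
move=> vf; elim: i => [|i IH]; first exact: value1.
by rewrite !exprS; exact: valueM.
Qed.

Lemma valueV f c : c != 0 -> has_value f P c -> has_value f^-1 P c^-1.
Proof.
move=> c0 vf; have f0 : f != 0.
  apply: contra_neqN c0 => /eqP f0; move: vf; rewrite f0 => vf.
  exact: value_uniq vf ((value0 0).2 vanishes0).
have ic0 : iota c != 0 by rewrite fmorph_eq0.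
have Of' : regular_at P f^-1.
  apply: regular_unit; first exact: value_regular vf.
  by move=> /value0 /(value_uniq vf) /eqP; rewrite (negPf c0).
rewrite /has_value; have -> : f^-1 - iota c^-1 = - (f^-1 * iota c^-1) * (f - iota c).
  by rewrite fmorphV mulNr mulrBr mulrAC mulVf // mul1r -mulrA mulVf // mulr1 opprB.
apply: vanishesMl => //; apply/regularN/regularM => //; exact: regular_iota.
Qed.

Lemma value_div f g c d : d != 0 -> has_value f P c -> has_value g P d ->
  has_value (f / g) P (c / d).
Proof. by move=> d0 vf vg; apply: valueM => //; exact: valueV. Qed.

Lemma value_sum (I : Type) (r : seq I) (F : I -> K) (G : I -> k) :
  (forall i, has_value (F i) P (G i)) ->
  has_value (\sum_(i <- r) F i) P (\sum_(i <- r) G i).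
Proof.
move=> FG; elim/big_ind2: _ => //; last by move=> *; exact: valueD.
exact/value0/vanishes0.
Qed.

Lemma value_prod (I : Type) (r : seq I) (F : I -> K) (G : I -> k) :
  (forall i, has_value (F i) P (G i)) ->
  has_value (\prod_(i <- r) F i) P (\prod_(i <- r) G i).
Proof.
move=> FG; elim/big_ind2: _ => //; last by move=> *; exact: valueM.
exact/value1.
Qed.

Lemma value_mpoly i (u : 'I_i -> K) (v : 'I_i -> k) (p : {mpoly k[i]}) :
  (forall j, has_value (u j) P (v j)) ->
  has_value (map_mpoly iota p).@[u] P p.@[v].
Proof.
move=> uv; elim/mpolyind: p => [|c mm p _ _ IH].
  by rewrite rmorph0 /= !meval0; exact/value0/vanishes0.
rewrite rmorphD !mevalD; apply: valueD => //.
rewrite /= map_mpolyZ map_mpolyX !mevalZ; apply: valueM; first exact: value_iota.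
by rewrite !mevalX; apply: value_prod => j; exact: valueX.
Qed.

End OnePlace.

Lemma aut_actM (s s' : curve_aut iota) P :
  aut_act (s * s')%g P = aut_act s (aut_act s' P).
Proof. exact: place_eq. Qed.

Lemma aut_act1 P : aut_act 1%g P = P.
Proof. exact: place_eq. Qed.

Lemma aut_vanishes (s : curve_aut iota) f P :
  vanishes f (aut_act s P) <-> vanishes (pullback s f) P.
Proof.
rewrite /vanishes /has_pole /= fmorphV; split=> -[? [f0|?]]; split=> //; try by [right].
  by left; rewrite f0 rmorph0.
by left; apply/eqP; rewrite -(fmorph_eq0 (pullback s)) /= f0.
Qed.

Lemma aut_value (s : curve_aut iota) f P c :
  has_value f (aut_act s P) c <-> has_value (pullback s f) P c.
Proof. by rewrite /has_value aut_vanishes rmorphB /= pullback_iota. Qed.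

Lemma aut_pole (s : curve_aut iota) f P :
  has_pole f (aut_act s P) <-> has_pole (pullback s f) P.
Proof. by []. Qed.

End Places.

(** * Subfields, automorphisms, and evaluation of polynomials *)

Section Subextensions.
Context (k : closedFieldType) (K : fieldType) (iota : {rmorphism k -> K}).

Lemma subextensionP (L : set K) :
  subextension iota L <->
  [/\ forall f g, L f -> L g -> L (f - g), forall f g, L f -> L g -> L (f / g)
    & forall c, L (iota c)].
Proof.
split=> [[[L1 LB LV] kL]|[LB LV kL]].
  split=> [f g|f g|c].
  - by have := LB f g; rewrite !inE.
  - by have := LV f g; rewrite !inE.
  - by apply: kL; exists c.
split; last by move=> _ [c _ <-].
split=> [|f g|f g]; rewrite !inE; [|exact: LB|exact: LV].
by rewrite -(rmorph1 iota).
Qed.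

Lemma subextensionD (L : set K) f g : subextension iota L -> L f -> L g -> L (f + g).
Proof.
move=> /subextensionP[LB _ kL] Lf Lg; rewrite -[g]opprK; apply: (LB) => //.
by rewrite -sub0r -(rmorph0 iota); apply: LB.
Qed.

Lemma subextensionM (L : set K) f g : subextension iota L -> L f -> L g -> L (f * g).
Proof.
move=> /subextensionP[_ LV kL] Lf Lg; rewrite -[g]invrK; apply: (LV) => //.
by rewrite -div1r -(rmorph1 iota); apply: LV.
Qed.

Lemma subextensionX (L : set K) f i : subextension iota L -> L f -> L (f ^+ i).
Proof.
move=> sL Lf; elim: i => [|i IH]; last by rewrite exprS; exact: subextensionM.
by have /subextensionP[_ _] := sL; rewrite expr0 -(rmorph1 iota).
Qed.

Lemma adjoin_min (S L : set K) :
  subextension iota L -> S `<=` L -> adjoin iota S `<=` L.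
Proof. by move=> sL SL f; apply. Qed.

Lemma adjoin_gen (S : set K) : S `<=` adjoin iota S.
Proof. by move=> f Sf L [_]; apply. Qed.

Lemma adjoin_subextension (S : set K) : subextension iota (adjoin iota S).
Proof.
apply/subextensionP; split=> [f g Sf Sg|f g Sf Sg|c] L [sL SL];
  case/subextensionP: (sL) => LB LV kL.
- by apply: LB; [exact: Sf|exact: Sg].
- by apply: LV; [exact: Sf|exact: Sg].
- exact: kL.
Qed.

Lemma invariants_subextension (G : set (curve_aut iota)) :
  subextension iota (invariants G).
Proof.
apply/subextensionP; split=> [f g Gf Gg s Gs|f g Gf Gg s Gs|c s Gs].
- by rewrite rmorphB /= Gf // Gg.
- by rewrite fmorph_div /= Gf // Gg.
- by rewrite pullback_iota.
Qed.

Lemma endo_generators (S : set K) (phi psi : {rmorphism K -> K}) :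
    adjoin iota S = setT ->
    (forall c, phi (iota c) = psi (iota c)) ->
    (forall f, S f -> phi f = psi f) ->
  phi =1 psi.
Proof.
move=> gen pk pS f; have : [set: K] f by [].
rewrite -gen; apply: (adjoin_min (L := [set h | phi h = psi h])) => //.
apply/subextensionP; split=> /= [a b ea eb|a b ea eb|//].
  by rewrite !rmorphB ea eb.
by rewrite !fmorph_div ea eb.
Qed.

End Subextensions.

Section Evaluation.
Context (k : fieldType) (L : comNzRingType) (j : {rmorphism k -> L}).

Definition ev3 (a b c : L) : {mpoly k[3]} -> L :=
  meval (tnth [tuple a; b; c]) \o map_mpoly j.

HB.instance Definition _ a b c :=
  GRing.RMorphism.copy (ev3 a b c) (meval (tnth [tuple a; b; c]) \o map_mpoly j).

Definition i0 : 'I_3 := @Ordinal 3 0 isT.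
Definition i1 : 'I_3 := @Ordinal 3 1 isT.
Definition i2 : 'I_3 := @Ordinal 3 2 isT.

Lemma ord3P (i : 'I_3) : [\/ i = i0, i = i1 | i = i2].
Proof.
by case: i => [[|[|[|//]]] ?]; [apply: Or31|apply: Or32|apply: Or33]; apply: val_inj.
Qed.

Lemma big_ord3 (R : Type) (idx : R) (op : Monoid.law idx) (F : 'I_3 -> R) :
  \big[op/idx]_(i < 3) F i = op (F i0) (op (F i1) (F i2)).
Proof.
rewrite !big_ord_recl big_ord0 Monoid.mulm1.
by congr (op (F _) (op (F _) (F _))); apply: val_inj.
Qed.

Lemma ev3C a b c d : ev3 a b c d%:MP = j d.
Proof. by rewrite /ev3 /= map_mpolyC mevalC. Qed.

Lemma ev3B a b c p r : ev3 a b c (p - r) = ev3 a b c p - ev3 a b c r.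
Proof. exact: rmorphB. Qed.

Lemma ev3M a b c p r : ev3 a b c (p * r) = ev3 a b c p * ev3 a b c r.
Proof. exact: rmorphM. Qed.

Lemma ev3Z a b c d p : ev3 a b c (d *: p) = j d * ev3 a b c p.
Proof. by rewrite /ev3 /= map_mpolyZ mevalZ. Qed.

Lemma ev3X a b c m : ev3 a b c 'X_[m] = a ^+ m i0 * (b ^+ m i1 * c ^+ m i2).
Proof. by rewrite /ev3 /= map_mpolyX mevalX big_ord3. Qed.

Lemma ev3Xi a b c i : ev3 a b c 'X_i = tnth [tuple a; b; c] i.
Proof. by rewrite /ev3 /= map_mpolyX mevalXU. Qed.

Definition zpoly (p : {poly k}) : {mpoly k[3]} := (map_poly (@mpolyC 3 k) p).['X_i2].

Lemma ev3_zpoly a b c p : ev3 a b c (zpoly p) = (map_poly j p).[c].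
Proof.
rewrite /zpoly -horner_map -map_poly_comp /= ev3Xi; congr (_.[_]).
by apply: eq_map_poly => d /=; rewrite ev3C.
Qed.

End Evaluation.

Lemma ev3_id (k : fieldType) (a b c : k) (p : {mpoly k[3]}) :
  ev3 idfun a b c p = p.@[tnth [tuple a; b; c]].
Proof.
by rewrite /ev3 /=; congr (_.@[_]); apply/mpolyP => m; rewrite mcoeff_map_mpoly.
Qed.

Lemma coef_eq0_roots (L : fieldType) N (f : 'I_N -> L) (F : nat -> L) :
    injective f -> (forall s, \sum_(l < N) F l * f s ^+ l = 0) ->
  forall l, (l < N)%N -> F l = 0.
Proof.
move=> finj fz l lN; set p := \poly_(l < N) F l.
suff p0 : p = 0 by have := coef_poly N F l; rewrite -/p p0 coef0 lN.
apply/eqP; apply: contraT => p0; rewrite -(ltnn N).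
have rootp : all (root p) [seq f s | s <- enum 'I_N].
  by apply/allP => _ /mapP[s _ ->]; rewrite /root horner_poly fz.
have := max_poly_roots p0 rootp.
rewrite map_inj_uniq ?enum_uniq // size_map size_enum_ord => /(_ isT) pN.
exact: leq_trans pN (size_poly _ _).
Qed.

(** * The coordinate ring *)

Section Reduction.
Context (n : nat) (k : closedFieldType) (k2 : 2%N \in [pchar k]).
Local Notation q0 := (2 ^ n)%N.
Local Notation q := (2 * q0 ^ 2)%N.
Local Notation m := (q - 2 * q0 + 1)%N.

Definition reduced_form (c : nat -> nat -> {poly k}) (L : fieldType)
    (j : {rmorphism k -> L}) (a b d : L) : L :=
  \sum_(i < q) \sum_(l < q) (map_poly j (c i l)).[d] * a ^+ i * b ^+ l.

(** The coefficients depend on [p] only: the same reduced form serves at all points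
    over all extensions of [k], in particular over [k] and over [K]. *)
Definition reducible (p : {mpoly k[3]}) : Prop :=
  exists c, forall (L : fieldType) (j : {rmorphism k -> L}) (a b d : L),
    on_curve n a b d -> ev3 j a b d p = reduced_form c j a b d.

Lemma eq_reducible p p' :
    (forall (L : fieldType) (j : {rmorphism k -> L}) (a b d : L),
      on_curve n a b d -> ev3 j a b d p = ev3 j a b d p') ->
  reducible p' -> reducible p.
Proof. by move=> pp' [c cE]; exists c => L j a b d C; rewrite pp' ?cE. Qed.

Lemma reducibleD p p' : reducible p -> reducible p' -> reducible (p + p').
Proof.
move=> [c cE] [c' cE']; exists (fun i l => c i l + c' i l) => L j a b d C.
rewrite rmorphD /= cE // cE' // -big_split /=; apply: eq_bigr => i _.
rewrite -big_split /=; apply: eq_bigr => l _.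
by rewrite rmorphD hornerD !mulrDl.
Qed.

Lemma reducible_zpoly r p : reducible p -> reducible (zpoly r * p).
Proof.
move=> [c cE]; exists (fun i l => r * c i l) => L j a b d C.
rewrite rmorphM /= ev3_zpoly cE // mulr_sumr; apply: eq_bigr => i _.
by rewrite mulr_sumr; apply: eq_bigr => l _; rewrite rmorphM hornerM !mulrA.
Qed.

(** Lexicographic induction: the equation for [y ^ q] lowers [l] and raises [i], the
    equation for [x ^ q] lowers [i]. *)
Lemma reducible_monomial i l : reducible ('X_i0 ^+ i * 'X_i1 ^+ l).
Proof.
have [N leN] := ubnP l.
elim: N l leN i => // N IHN l leN i.
have [M leM] := ubnP i; elim: M i leM => // M IHM i leM.
have [ql|lq] := leqP q l.
  have [l' lE] : exists l', l = (l' + q)%N by exists (l - q)%N; rewrite subnK.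
  apply: (@eq_reducible _ ('X_i0 ^+ i * 'X_i1 ^+ (l' + 1)
     + ('X_i0 ^+ (i + q0 + q) * 'X_i1 ^+ l' + 'X_i0 ^+ (i + q0 + 1) * 'X_i1 ^+ l'))).
    move=> L j a b d C; have L2 := rmorph_pchar j k2.
    rewrite lE !(rmorphD, rmorphM, rmorphXn) /= !ev3Xi /= !(tnth_nth 0) /=.
    rewrite [b ^+ (l' + q)]exprD (yq L2 C) -C.2 !exprD !expr1; ring.
  have := q_gt1 n => q1.
  by apply: reducibleD; [|apply: reducibleD]; apply: IHN; lia.
have [qi|iq] := leqP q i.
  have [i' iE] : exists i', i = (i' + q)%N by exists (i - q)%N; rewrite subnK.
  apply: (@eq_reducible _ ('X_i0 ^+ (i' + 1) * 'X_i1 ^+ l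
     + zpoly 'X^m * ('X_i0 ^+ i' * 'X_i1 ^+ l))).
    move=> L j a b d C; have L2 := rmorph_pchar j k2.
    rewrite iE !(rmorphD, rmorphM, rmorphXn) /= ev3_zpoly !ev3Xi /= !(tnth_nth 0) /=.
    rewrite map_polyXn hornerXn [a ^+ (i' + q)]exprD (xq L2 C) !exprD !expr1; ring.
  have := q_gt1 n => q1.
  by apply: reducibleD; [|apply: reducible_zpoly]; apply: IHM; lia.
exists (fun i' l' => if (i' == i) && (l' == l) then 1 else 0) => L j a b d C.
rewrite /reduced_form (bigD1 (Ordinal iq)) //= (bigD1 (Ordinal lq)) //= !eqxx.
rewrite big1 => [|l' ne]; last first.
  by rewrite -val_eqE /= in ne; rewrite (negPf ne) map_poly0 horner0 !mul0r.
rewrite big1 => [|i' ne]; last first.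
  rewrite big1 // => l' _; rewrite -val_eqE /= in ne.
  by rewrite (negPf ne) map_poly0 horner0 !mul0r.
rewrite rmorph1 hornerC !addr0 mul1r rmorphM !rmorphXn /= !ev3Xi.
by rewrite !(tnth_nth 0).
Qed.

(** Modulo the equations, which are monic in [y] and in [x], every polynomial
    is a combination of the monomials [x ^ i * y ^ l] with [i, l < q], with
    coefficients in [k[z]]. *)
Lemma reducibleT p : reducible p.
Proof.
elim/mpolyind: p => [|c mm p _ _ IH].
  exists (fun _ _ => 0) => L j a b d _; rewrite rmorph0 /reduced_form big1 // => i _.
  by rewrite big1 // => l _; rewrite map_poly0 horner0 !mul0r.
apply: reducibleD => //.
apply: (@eq_reducible _ (zpoly (c *: 'X^(mm i2)) * ('X_i0 ^+ mm i0 * 'X_i1 ^+ mm i1))).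
  move=> L j a b d C; rewrite ev3Z ev3X !(rmorphM, rmorphXn) /= ev3_zpoly !ev3Xi.
  by rewrite !(tnth_nth 0) /= map_polyZ map_polyXn hornerZ hornerXn; ring.
by apply: reducible_zpoly; exact: reducible_monomial.
Qed.

(** Over each value [d] of [z] the points of the curve form a set of [q ^ 2]
    elements, [q] values of [x] with [q] values of [y] each, on which a reduced
    form with a non-zero coefficient cannot vanish. *)
Lemma reduced_form_inj c :
    (forall a b d : k, on_curve n a b d -> reduced_form c idfun a b d = 0) ->
  forall i l, (i < q)%N -> (l < q)%N -> c i l = 0.
Proof.
move=> cz i l iq lq; apply/eqP; apply: contraT => /closed_nonrootP[d].
rewrite /root; have [e [einj eFq]] := Fq_enum n k2.
have eE s : e s ^+ q = e s by apply/eFq; exists s.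
have [a [b C]] := exists_on_curve n d.
have inner s : \sum_(i' < q) (c i' l).[d] * (a + e s) ^+ i' = 0.
  pose F l := \sum_(i' < q) (c i' l).[d] * (a + e s) ^+ i'.
  have C' s' := translate_on_curve k2 (eE s) (eE s') C.
  apply: (coef_eq0_roots (F := F) (f := fun s' => b + e s ^+ q0 * a + e s')) lq.
    by move=> s1 s2 /addrI/einj.
  move=> s'; have := cz _ _ _ (C' s').
  rewrite /reduced_form exchange_big /=; apply: etrans.
  apply: eq_bigr => l' _; rewrite mulr_suml; apply: eq_bigr => i' _.
  by rewrite map_poly_id.
rewrite (coef_eq0_roots (F := fun i => (c i l).[d]) (f := fun s => a + e s)) ?eqxx //.
by move=> s1 s2 /addrI/einj.
Qed.

End Reduction.

Section FunctionField.
Context (n : nat) (k : closedFieldType) (k2 : 2%N \in [pchar k]).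
Local Notation q0 := (2 ^ n)%N.
Local Notation q := (2 * q0 ^ 2)%N.
Local Notation m := (q - 2 * q0 + 1)%N.
Context (K : fieldType) (iota : {rmorphism k -> K}) (x y z : K).
Context (hK : is_function_field iota (affine_curve q0) (tnth [tuple x; y; z])).
Local Notation ev := (ev3 iota x y z).

Lemma pcharK : 2%N \in [pchar K]. Proof. exact: (rmorph_pchar iota k2). Qed.

Lemma ev_eq0 p : ev p = 0 <->
  forall a b d : k, on_curve n a b d -> ev3 idfun a b d p = 0.
Proof.
rewrite [ev p = 0](hK.1 p); split=> [pz a b d [C1 C2]|pz v [a [b [d [-> C1 C2]]]]].
  by rewrite ev3_id; apply: pz; exists a, b, d.
by rewrite -ev3_id; exact: pz.
Qed.

Lemma on_curveK : on_curve n x y z.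
Proof.
pose Xv i : {mpoly k[3]} := 'X_i.
have h p p' : (forall a b d : k, on_curve n a b d -> ev3 idfun a b d p = ev3 idfun a b d p') ->
    ev p = ev p'.
  move=> E1; apply/eqP; rewrite -subr_eq0 -rmorphB; apply/eqP/ev_eq0 => a b d C.
  by rewrite rmorphB /= E1 ?subrr.
split.
  have := h (Xv i1 ^+ q + Xv i1) (Xv i0 ^+ q0 * (Xv i0 ^+ q + Xv i0)).
  rewrite !(rmorphM, rmorphD, rmorphXn) /= !ev3Xi !(tnth_nth 0) /=; apply=> a b d [C _].
  by rewrite !(rmorphM, rmorphD, rmorphXn) /= !ev3Xi !(tnth_nth 0).
have := h (Xv i0 ^+ q + Xv i0) (Xv i2 ^+ m).
rewrite !(rmorphD, rmorphXn) /= !ev3Xi !(tnth_nth 0) /=; apply=> a b d [_ C].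
by rewrite !(rmorphD, rmorphXn) /= !ev3Xi !(tnth_nth 0).
Qed.

(** The reduced form of a relation vanishes identically, so every relation follows
    from the two equations and holds at all their solutions. *)
Lemma ev_ker p : ev p = 0 -> forall (L : fieldType) (j : {rmorphism k -> L}) a b d,
  on_curve n a b d -> ev3 j a b d p = 0.
Proof.
move=> /ev_eq0 pz L j a b d C; have [c cE] := reducibleT n k2 p.
have c0 := reduced_form_inj k2 (c := c) (fun a b d C => etrans (esym (cE _ _ _ _ _ C)) (pz _ _ _ C)).
rewrite cE // /reduced_form big1 // => i _; rewrite big1 // => l _.
by rewrite c0 // map_poly0 horner0 !mul0r.
Qed.

Lemma z_transcendental (p : {poly k}) : (map_poly iota p).[z] = 0 -> p = 0.
Proof.
rewrite -(ev3_zpoly iota x y) => /ev_eq0 pz; apply/eqP; apply: contraT.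
move=> /closed_nonrootP[d]; have [a [b C]] := exists_on_curve n d.
by have := pz _ _ _ C; rewrite ev3_zpoly map_poly_id // /root => ->; rewrite eqxx.
Qed.

Lemma gen_xyz : adjoin iota [set f | [\/ f = x, f = y | f = z]] = setT.
Proof.
rewrite -hK.2; congr (adjoin iota _); apply/seteqP; split=> f /=.
  by case=> ->; [exists i0|exists i1|exists i2].
by case=> i _ <-; rewrite (tnth_nth 0); case: (ord3P i) => -> /=;
  [apply: Or31|apply: Or32|apply: Or33].
Qed.

Lemma ev_frac h : exists p r, ev r != 0 /\ h = ev p / ev r.
Proof.
have : [set: K] h by [].
rewrite -gen_xyz; apply: (adjoin_min (L := [set h | exists p r, ev r != 0 /\ h = ev p / ev r])).
  apply/subextensionP; split=> [_ _ [p [r [r0 ->]]] [p' [r' [r0' ->]]]|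
      _ _ [p [r [r0 ->]]] [p' [r' [r0' ->]]]|c].
  - exists (p * r' - p' * r), (r * r'); split.
      by rewrite ev3M; exact: (mulf_neq0 r0 r0').
    by rewrite ev3B !ev3M -[in LHS]mulNr addf_div // mulNr.
  - have [p0|p0] := eqVneq (ev p') 0.
      by exists 0, 1; rewrite rmorph1 oner_eq0 p0 mul0r invr0 mulr0 rmorph0 mul0r.
    exists (p * r'), (r * p'); split.
      by rewrite ev3M; exact: (mulf_neq0 r0 p0).
    by rewrite !ev3M invf_div mulf_div.
  - by exists c%:MP, 1; rewrite rmorph1 oner_eq0 divr1 ev3C.
by move=> _ [] ->; [exists 'X_i0|exists 'X_i1|exists 'X_i2]; exists 1;
  rewrite rmorph1 oner_eq0 divr1 ev3Xi (tnth_nth 0).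
Qed.

(** By [ev_ker] the relations between [x], [y] and [z] hold at [(a, b, d)]; if no
    others do, then [(x, y, z)] specialises to [(a, b, d)]. *)
Lemma endo_of_point a b d : on_curve n a b d ->
    (forall p, ev3 iota a b d p = 0 -> ev p = 0) ->
  exists phi : {rmorphism K -> K}, forall p, phi (ev p) = ev3 iota a b d p.
Proof.
move=> C ker.
have ker' p : (ev3 iota a b d p == 0) = (ev p == 0).
  by apply/eqP/eqP => [/ker//|p0]; exact: ev_ker p0 _ _ _ _ _ C.
exact: fraction_extension ev_frac ker'.
Qed.

Lemma aut_of_endo (phi psi : {rmorphism K -> K}) :
    (forall c, phi (iota c) = iota c) -> (forall c, psi (iota c) = iota c) ->
    (forall f, [\/ f = x, f = y | f = z] -> psi (phi f) = f) ->
    (forall f, [\/ f = x, f = y | f = z] -> phi (psi f) = f) ->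
  exists s : curve_aut iota, pullback s =1 phi.
Proof.
move=> phik psik psiphi phipsi.
have K1 : cancel phi psi.
  apply: (endo_generators (psi := idfun) (phi := psi \o phi) gen_xyz) => //= c.
  by rewrite phik psik.
have K2 : cancel psi phi.
  apply: (endo_generators (psi := idfun) (phi := phi \o psi) gen_xyz) => //= c.
  by rewrite psik phik.
have phiM : monoid_morphism phi by split=> [|f g]; rewrite ?rmorph1 ?rmorphM.
by exists (CurveAut (rmorphB phi) phiM phik K1 K2).
Qed.

Lemma eq_aut (s t : curve_aut iota) :
  pullback s x = pullback t x -> pullback s y = pullback t y ->
  pullback s z = pullback t z -> s = t.
Proof.
move=> ex ey ez; apply: curve_aut_eq.
apply: (endo_generators (phi := pullback s) (psi := pullback t) gen_xyz) => [c|f].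
  by rewrite /= !pullback_iota.
by case=> ->.
Qed.

(** ** The group G1 *)

Local Notation G1 := (group_G1 iota q0 x y z).

Lemma G1_inj s t : G1 s -> G1 t -> pullback s x = pullback t x ->
  pullback s y = pullback t y -> s = t.
Proof. by move=> [a [b [_ _ _ zE]]] [c [d [_ _ _ zE']]] ??; apply: eq_aut; rewrite ?zE. Qed.

(** A translation substitutes polynomials in the relations, and the inverse
    translation, with [b + a ^ (q0 + 1)] for [b], carries them back. *)
Lemma translation_endo a b : a ^+ q = a -> b ^+ q = b ->
  exists phi : {rmorphism K -> K}, [/\ forall c, phi (iota c) = iota c,
    phi x = x + iota a, phi y = y + iota (a ^+ q0) * x + iota b & phi z = z].
Proof.
move=> aq bq; pose sub a b : 3.-tuple {mpoly k[3]} :=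
  [tuple 'X_i0 + a%:MP; 'X_i1 + (a ^+ q0)%:MP * 'X_i0 + b%:MP; 'X_i2].
have subE (c d : k) f g h p : ev3 iota f g h (p \mPo sub c d)
    = ev3 iota (f + iota c) (g + iota (c ^+ q0) * f + iota d) h p.
  elim/mpolyind: p => [|e mm p _ _ IH]; first by rewrite !rmorph0.
  rewrite comp_mpolyD !rmorphD /= IH comp_mpolyZ comp_mpolyX !ev3Z ev3X big_ord3.
  rewrite !rmorphM !rmorphXn /= !(tnth_nth 0) /= !(rmorphD, rmorphM) /=.
  by rewrite !ev3Xi !(tnth_nth 0) /= !ev3C !rmorphXn.
have C (c d : k) : c ^+ q = c -> d ^+ q = d ->
    on_curve n (x + iota c) (y + iota (c ^+ q0) * x + iota d) z.
  move=> cq dq; rewrite rmorphXn /=; apply: (translate_on_curve pcharK _ _ on_curveK).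
    by rewrite -rmorphXn cq.
  by rewrite -rmorphXn dq.
have [|phi phiE] := endo_of_point (C a b aq bq).
  move=> p; rewrite -subE => /ev_ker.
  move=> /(_ K iota _ _ _ (C a (b + a ^+ q0 * a) aq _)).
  rewrite subE => <-; last first.
    by rewrite expqD // bq exprMn exprAC aq.
  rewrite /ev3 /=; congr (_.@[_]); apply/funext => i.
  have a2 (f : K) : f + f = 0 by rewrite addrr_pchar2 // pcharK.
  rewrite !(tnth_nth 0); case: (ord3P i) => -> //=.
    by rewrite -addrA a2 addr0.
  rewrite rmorphD rmorphM mulrDr; apply: (eq_pchar2 pcharK
    (c := - (iota (a ^+ q0) * x + iota (a ^+ q0) * iota a + iota b))); ring.
exists phi; split=> [c|||].
- by have := phiE c%:MP; rewrite !ev3C.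
- by have := phiE 'X_i0; rewrite !ev3Xi !(tnth_nth 0).
- by have := phiE 'X_i1; rewrite !ev3Xi !(tnth_nth 0).
- by have := phiE 'X_i2; rewrite !ev3Xi !(tnth_nth 0).
Qed.

Lemma translation_exists a b : a ^+ q = a -> b ^+ q = b ->
  exists s : curve_aut iota, [/\ pullback s x = x + iota a,
    pullback s y = y + iota (a ^+ q0) * x + iota b & pullback s z = z].
Proof.
move=> aq bq; have [phi [phik px py pz]] := translation_endo aq bq.
have bq' : (b + a ^+ q0 * a) ^+ q = b + a ^+ q0 * a.
  by rewrite expqD // bq exprMn exprAC aq.
have [psi [psik px' py' pz']] := translation_endo aq bq'.
have a2 (f : K) : f + f = 0 by rewrite addrr_pchar2 // pcharK.
have [||s sE] := aut_of_endo phik psik; last first.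
- by exists s; rewrite !sE.
- move=> _ [] ->; rewrite ?px' ?py' ?pz' ?rmorphD ?rmorphM /= ?px ?py ?phik //.
    by rewrite -addrA a2 addr0.
  by apply: (eq_pchar2 pcharK (c := (iota (a ^+ q0) * x + iota (a ^+ q0) * iota a + iota b))); ring.
- move=> _ [] ->; rewrite ?px ?py ?pz ?rmorphD ?rmorphM /= ?px' ?py' ?psik //.
    by rewrite -addrA a2 addr0.
  rewrite rmorphD rmorphM /=.
  by apply: (eq_pchar2 pcharK (c := (iota (a ^+ q0) * x + iota (a ^+ q0) * iota a + iota b))); ring.
Qed.

Lemma G1M s t : G1 s -> G1 t -> G1 (s * t)%g.
Proof.
move=> [a [b [[aq bq] sx sy sz]]] [c [d [[cq dq] tx ty tz]]].
exists (a + c), (b + d + a ^+ q0 * c); split=> /=.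
- by rewrite !expqD // exprMn [(a ^+ q0) ^+ q]exprAC aq bq cq dq.
- by rewrite sx rmorphD /= tx pullback_iota rmorphD; ring.
- rewrite sy !rmorphD rmorphM /= tx ty !pullback_iota exp2nD // !rmorphD rmorphM /=.
  by ring.
- by rewrite sz.
Qed.

Lemma G1_one : G1 1%g.
Proof.
exists 0, 0; have q_gt0 := ltnW (q_gt1 n).
by rewrite !expr0n !gtn_eqF ?q0_gt0 //= !rmorph0 mul0r !addr0.
Qed.

(** An indexing of [G1] by a finite type, for products over the group. *)
Lemma G1_enum : exists g : 'I_q * 'I_q -> curve_aut iota,
  [/\ injective g, forall i, G1 (g i) & forall s, G1 s -> exists i, s = g i].
Proof.
have [e [einj eFq]] := Fq_enum n k2.
have eE i : e i ^+ q = e i by apply/eFq; exists i.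
pose g i := sval (cid (translation_exists (eE i.1) (eE i.2))).
have gP i : [/\ pullback (g i) x = x + iota (e i.1),
    pullback (g i) y = y + iota (e i.1 ^+ q0) * x + iota (e i.2) & pullback (g i) z = z].
  by rewrite /g; case: cid.
have gG i : G1 (g i) by have [? ? ?] := gP i; exists (e i.1), (e i.2).
exists g; split=> // [i i' gi|s [a [b [[/eFq[i ->] /eFq[i' ->]] sx sy sz]]]].
  have [gx gy _] := gP i; have [gx' gy' _] := gP i'.
  move: gx' gy'; rewrite -gi gx gy => /addrI/fmorph_inj/einj i1E.
  rewrite i1E => /addrI/fmorph_inj/einj i2E.
  by case: (i) (i') i1E i2E => [? ?] [? ?] /= -> ->.
exists (i, i'); have [gx gy _] := gP (i, i').
by apply: G1_inj => //; [exists (e i), (e i'); split=> // | rewrite sx gx|rewrite sy gy].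
Qed.

End FunctionField.

(** * The quotient by G1 *)

Lemma coef_prod_XsubC_closed (K : fieldType) (S : set K) (rs : seq K) :
    S 1 -> (forall a b, S a -> S b -> S (a - b)) ->
    (forall a b, S a -> S b -> S (a * b)) -> (forall r, r \in rs -> S r) ->
  forall i, S (\prod_(r <- rs) ('X - r%:P))`_i.
Proof.
move=> S1 SB SM; have S0 : S 0 by rewrite -(subrr 1); apply: SB.
elim: rs => [|r rs IH] Sr i; first by rewrite big_nil coef1; case: (i == 0%N).
have Sp := IH (fun r rs_r => Sr _ (mem_behead (s := _ :: _) rs_r)).
have Sr0 := Sr r (mem_head _ _); rewrite big_cons mulrBl coefB coefXM coefCM.
by apply: SB; [case: (i == 0%N)|apply: SM].
Qed.

Section Invariants.
Context (n : nat) (k : closedFieldType) (k2 : 2%N \in [pchar k]).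
Local Notation q0 := (2 ^ n)%N.
Local Notation q := (2 * q0 ^ 2)%N.
Context (K : fieldType) (iota : {rmorphism k -> K}) (x y z : K).
Context (hK : is_function_field iota (affine_curve q0) (tnth [tuple x; y; z])).
Local Notation ev := (ev3 iota x y z).
Local Notation G1 := (group_G1 iota q0 x y z).

Definition g1 := sval (cid (G1_enum k2 hK)).
Local Notation g := g1.

Lemma g1_inj : injective g. Proof. by case: (svalP (cid (G1_enum k2 hK))). Qed.
Lemma g1_in i : G1 (g i). Proof. by case: (svalP (cid (G1_enum k2 hK))). Qed.
Lemma g1_surj s : G1 s -> exists i, s = g i.
Proof. by case: (svalP (cid (G1_enum k2 hK))) => _ _; apply. Qed.

(** The characteristic polynomial of [f] over the field of [G1]. *)
Definition chi (f : K) : {poly K} := \prod_i ('X - (pullback (g i) f)%:P).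

Lemma chi_monic f : chi f \is monic.
Proof. by apply: monic_prod => i _; exact: monicXsubC. Qed.

Lemma size_chi f : size (chi f) = (q ^ 2).+1.
Proof. by rewrite /chi size_prod_XsubC /index_enum -enumT -cardE card_prod card_ord. Qed.

Lemma chi_root f : root (chi f) f.
Proof.
have [i gi] := g1_surj (G1_one n iota x y z).
by rewrite /root /chi (bigD1 i) //= hornerM -gi /= hornerXsubC subrr mul0r.
Qed.

Lemma map_chi s f : G1 s -> map_poly (pullback s) (chi f) = chi f.
Proof.
move=> Gs; have hP i : exists i', (g i * s)%g = g i'.
  exact: g1_surj (G1M k2 (g1_in i) Gs).
pose h i := sval (cid (hP i)); have hE i : (g i * s)%g = g (h i) by rewrite /h; case: cid.
have hinj : injective h.
  move=> i i' hi; apply: g1_inj; apply: (mulIg s).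
  by rewrite !hE hi.
rewrite /chi rmorph_prod [RHS](reindex_inj hinj) /=; apply: eq_bigr => i _.
by rewrite rmorphB /= map_polyX map_polyC /= -hE.
Qed.

Lemma chi_coef_inv f i : invariants G1 (chi f)`_i.
Proof.
by move=> s Gs; rewrite -[in RHS](map_chi f Gs) coef_map.
Qed.

Lemma aut_ev (s : curve_aut iota) p :
  pullback s (ev p) = ev3 iota (pullback s x) (pullback s y) (pullback s z) p.
Proof.
elim/mpolyind: p => [|c mm p _ _ IH]; first by rewrite !rmorph0.
rewrite !rmorphD /= IH !ev3Z !ev3X !rmorphM !rmorphXn /=.
by rewrite pullback_iota.
Qed.

Lemma ev3_in_range a b d p : range ev a -> range ev b -> range ev d ->
  range ev (ev3 iota a b d p).
Proof.
move=> [pa _ <-] [pb _ <-] [pd _ <-].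
elim/mpolyind: p => [|c mm p _ _ [p' _ pE]]; first by exists 0; rewrite ?rmorph0.
exists (c%:MP * (pa ^+ mm i0 * (pb ^+ mm i1 * pd ^+ mm i2)) + p') => //.
by rewrite rmorphD /= pE rmorphD /= ev3Z ev3X !rmorphM !rmorphXn /= ev3C.
Qed.

Lemma G1_ev s p : G1 s -> range ev (pullback s (ev p)).
Proof.
move=> [a [b [_ sx sy sz]]]; rewrite aut_ev sx sy sz; apply: ev3_in_range.
- exists ('X_i0 + a%:MP) => //.
  by rewrite rmorphD /= ev3Xi ev3C (tnth_nth 0).
- exists ('X_i1 + (a ^+ q0)%:MP * 'X_i0 + b%:MP) => //.
  by rewrite !rmorphD rmorphM /= !ev3Xi !ev3C !(tnth_nth 0).
- by exists 'X_i2; rewrite // ev3Xi (tnth_nth 0).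
Qed.

Lemma chi_coef_range p i : range ev (chi (ev p))`_i.
Proof.
rewrite /chi -(big_map (fun i => pullback (g i) (ev p)) predT (fun r => 'X - r%:P)).
apply: coef_prod_XsubC_closed.
- by exists 1; rewrite ?rmorph1.
- by move=> _ _ [a _ <-] [b _ <-]; exists (a - b); rewrite ?rmorphB.
- by move=> _ _ [a _ <-] [b _ <-]; exists (a * b); rewrite ?rmorphM.
- by move=> _ /mapP[j _ ->]; apply: G1_ev; exact: g1_in.
Qed.

(** An invariant combination of the [x ^ i * y ^ l], evaluated at the [q ^ 2]
    translates of the generic point, is a polynomial of degree less than [q] in
    each variable that takes the same value on a grid of size [q], hence is
    constant. *)
Lemma range_invariant f : range ev f -> invariants G1 f ->
  exists c : {poly k}, f = (map_poly iota c).[z].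
Proof.
move=> [p _ pE] fG; have [c cE] := reducibleT n k2 p.
have [e [einj eFq]] := Fq_enum n k2.
have eE i : e i ^+ q = e i by apply/eFq; exists i.
have fE s s' : f = reduced_form n c iota (x + iota (e s))
    (y + iota (e s ^+ q0) * x + iota (e s')) z.
  have [t [tx ty tz]] := translation_exists k2 hK (eE s) (eE s').
  have Gt : G1 t by exists (e s), (e s').
  rewrite -(fG t Gt) -pE aut_ev cE ?tx ?ty ?tz // rmorphXn.
  apply: (translate_on_curve (pcharK k2 iota) _ _ (on_curveK hK)).
    by rewrite -rmorphXn eE.
  by rewrite -rmorphXn eE.
have q_gt0 := ltnW (q_gt1 n).
have inner s : \sum_(i < q) (map_poly iota (c i 0%N)).[z] * (x + iota (e s)) ^+ i - f = 0.
  pose F l := \sum_(i < q) (map_poly iota (c i l)).[z] * (x + iota (e s)) ^+ i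
    - (if l == 0%N then f else 0).
  apply: (coef_eq0_roots (F := F)
    (f := fun s' => y + iota (e s ^+ q0) * x + iota (e s')) _ _ q_gt0).
    by move=> s1 s2 /addrI/fmorph_inj/einj.
  move=> s'; have := fE s s'; rewrite /reduced_form exchange_big /= => fE'.
  rewrite (eq_bigr (fun l : 'I_q => \sum_(i < q) (map_poly iota (c i l)).[z] *
      (x + iota (e s)) ^+ i * (y + iota (e s ^+ q0) * x + iota (e s')) ^+ l
     - (if l == 0%N :> nat then f else 0)
         * (y + iota (e s ^+ q0) * x + iota (e s')) ^+ l)); last first.
    by move=> l _; rewrite /F mulrBl mulr_suml.
  rewrite sumrB -fE' (bigD1 (Ordinal q_gt0)) //= expr0 mulr1 big1 ?addr0 ?subrr //.
  by move=> l; rewrite -val_eqE /= => /negPf ->; rewrite mul0r.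
pose F i := (map_poly iota (c i 0%N)).[z] - (if i == 0%N then f else 0).
exists (c 0%N 0%N); apply/esym/eqP; rewrite -subr_eq0; apply/eqP.
apply: (coef_eq0_roots (F := F) (f := fun s => x + iota (e s)) _ _ q_gt0).
  by move=> s1 s2 /addrI/fmorph_inj/einj.
move=> s; rewrite -[RHS](inner s).
under eq_bigr do rewrite /F mulrBl.
rewrite sumrB; congr (_ - _).
rewrite (bigD1 (Ordinal q_gt0)) //= expr0 mulr1 big1 ?addr0 //.
by move=> l; rewrite -val_eqE /= => /negPf ->; rewrite mul0r.
Qed.

Lemma chi_coefE p : exists c : nat -> {poly k},
  forall i, (chi (ev p))`_i = (map_poly iota (c i)).[z].
Proof.
have cP i := range_invariant (chi_coef_range p i) (@chi_coef_inv (ev p) i).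
by exists (fun i => sval (cid (cP i))) => i; case: cid.
Qed.

(** [c] is the norm of [ev p] to [k(z)], that is the constant coefficient of its
    characteristic polynomial. *)
Lemma norm_exists p : ev p != 0 -> exists p' (c : {poly k}),
  c != 0 /\ ev p * ev p' = (map_poly iota c).[z].
Proof.
move=> p0; have [c cE] := chi_coefE p.
have [i gi] := g1_surj (G1_one n iota x y z).
have c0E : (map_poly iota (c 0%N)).[z] = \prod_i (- pullback (g i) (ev p)).
  rewrite -cE -horner_coef0 /chi horner_prod; apply: eq_bigr => j _.
  by rewrite !hornerE.
have [p' _ pE'] : range ev (\prod_(j | j != i) (- pullback (g j) (ev p))).
  elim/big_ind: _ => [|_ _ [a _ <-] [b _ <-]|j _].
  - by exists 1; rewrite ?rmorph1.
  - by exists (a * b); rewrite ?rmorphM.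
  - by have [r _ <-] := G1_ev p (g1_in j); exists (- r); rewrite ?rmorphN.
exists (- p'), (c 0%N); split; last first.
  by rewrite c0E (bigD1 i) //= -gi /= rmorphN /= mulrN mulNr pE'.
apply: contra_neqN p0 => /eqP c0; move/eqP: c0E.
rewrite c0 rmorph0 horner0 eq_sym prodf_seq_eq0 => /hasP[j _] /=.
by rewrite oppr_eq0 fmorph_eq0 => /eqP.
Qed.

(** Multiplying numerator and denominator by the conjugates of the denominator moves
    the denominator to [k[z]], and then the numerator is invariant. *)
Lemma invariant_G1 f : invariants G1 f ->
  exists c d : {poly k}, d != 0 /\ f = (map_poly iota c).[z] / (map_poly iota d).[z].
Proof.
move=> fG; have [p [r [r0 fE]]] := ev_frac hK f.
have [r' [d [d0 rr']]] := norm_exists r0.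
have dz0 : (map_poly iota d).[z] != 0 by apply: contra_neq d0; exact: z_transcendental hK _.
have [|s Gs|c cE] := @range_invariant (f * (map_poly iota d).[z]).
- by exists (p * r'); rewrite // ev3M fE -rr' mulrA divfK.
- rewrite rmorphM /= fG //; congr (_ * _); rewrite -horner_map -map_poly_comp /=.
  have [a [b [_ _ _ ->]]] := Gs; congr (_.[_]); apply: eq_map_poly => e /=.
  exact: pullback_iota.
by exists c, d; split=> //; rewrite -cE mulfK.
Qed.

Definition z_morphism (p : {poly k}) : K := (map_poly iota p).[z].

HB.instance Definition _ :=
  GRing.RMorphism.copy z_morphism (horner_eval z \o map_poly iota).

(** The field of [G1] is [k(z)], with [z] transcendental. *)
Lemma quotient_G1 : quotient_is_P1 G1.
Proof.
have ker (p : {poly k}) : (z_morphism p == 0) = (tofrac p == 0).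
  rewrite tofrac_eq0; apply/eqP/eqP => [|->]; first exact: z_transcendental hK _.
  by rewrite /z_morphism rmorph0 horner0.
have [phi phiE] := fraction_extension (@fraction_quotient _) ker.
have phik c : phi (tofrac c%:P) = iota c.
  by rewrite phiE /= /z_morphism map_polyC hornerC.
exists phi; split=> //; apply/seteqP; split.
  move=> _ [h _ <-] s Gs; have [a [b [b0 ->]]] := fraction_quotient h.
  rewrite !fmorph_div /= !phiE /= /z_morphism; have [c [d [_ _ _ sz]]] := Gs.
  have sp (p : {poly k}) : pullback s (map_poly iota p).[z] = (map_poly iota p).[z].
    rewrite -horner_map -map_poly_comp /= sz; congr (_.[_]).
    by apply: eq_map_poly => e /=; exact: pullback_iota.
  by rewrite !sp.
move=> f /invariant_G1[c [d [d0 ->]]]; exists (tofrac c / tofrac d) => //.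
by rewrite fmorph_div /= !phiE.
Qed.

End Invariants.

(** * The involution xi *)

Lemma rmorph_alpha (K L : fieldType) (phi : {rmorphism K -> L}) q0 x y :
  phi (alpha q0 x y) = alpha q0 (phi x) (phi y).
Proof. by rewrite /alpha rmorphD !rmorphXn. Qed.

Lemma rmorph_beta (K L : fieldType) (phi : {rmorphism K -> L}) q0 x y :
  phi (beta q0 x y) = beta q0 (phi x) (phi y).
Proof. by rewrite /beta rmorphD rmorphM !rmorphXn rmorph_alpha. Qed.

Section Involution.
Context (n : nat) (k : closedFieldType) (k2 : 2%N \in [pchar k]).
Local Notation q0 := (2 ^ n)%N.
Context (K : fieldType) (iota : {rmorphism k -> K}) (x y z : K).
Context (hK : is_function_field iota (affine_curve q0) (tnth [tuple x; y; z])).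
Local Notation ev := (ev3 iota x y z).
Local Notation alpha := (alpha q0 x y).
Local Notation beta := (beta q0 x y).

Lemma z_neq0 : z != 0.
Proof.
apply/eqP => z0; have : (map_poly iota 'X).[z] = 0 by rewrite map_polyX hornerX.
by move/(z_transcendental hK)/eqP; rewrite polyX_eq0.
Qed.

Lemma beta_neq0 : beta != 0.
Proof.
apply/eqP => /(beta_eq0 (pcharK k2 iota) (on_curveK hK))[_ _ /eqP].
by rewrite (negPf z_neq0).
Qed.

Definition beta_poly : {mpoly k[3]} :=
  'X_i0 * 'X_i1 ^+ (2 * q0)
   + ('X_i1 ^+ (2 * q0) + 'X_i0 ^+ (2 * q0 + 1)) ^+ (2 * q0).

Lemma ev3_beta (L : fieldType) (j : {rmorphism k -> L}) a b c :
  ev3 j a b c beta_poly = Defs.beta q0 a b.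
Proof.
rewrite /beta_poly !(rmorphD, rmorphM, rmorphXn) /=.
by rewrite !ev3Xi !(tnth_nth 0).
Qed.

(** An algebraic element of [K] lies in [k], so the lemma says that [z = c beta] for
    no [c]; otherwise the point [(1, 0, 0)], where [beta = 1], gives [c = 0]. *)
Lemma t_transcendental (p : {poly k}) : (map_poly iota p).[z / beta] = 0 -> p = 0.
Proof.
have [rs ->] := closed_field_poly_normal p.
rewrite map_polyZ hornerZ => /eqP; rewrite mulf_eq0 fmorph_eq0 => /orP[/eqP->|].
  by rewrite scale0r.
rewrite rmorph_prod horner_prod prodf_seq_eq0 => /hasP[c _] /=.
rewrite rmorphB /= map_polyX map_polyC hornerXsubC subr_eq0 => /eqP zE.
have {zE} : ev ('X_i2 - c%:MP * beta_poly) = 0.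
  rewrite rmorphB rmorphM /= ev3Xi ev3C ev3_beta -zE divfK ?beta_neq0 //.
  by rewrite (tnth_nth 0) subrr.
move=> zE; have C : on_curve n 1 0 (0 : k).
  rewrite /on_curve !expr1n !expr0n !gtn_eqF ?(ltnW (q_gt1 n)) ?m_gt0 //.
  by rewrite (addrr_pchar2 k2 1) mulr0 addr0.
have := ev_ker k2 hK zE idfun C.
rewrite rmorphB rmorphM /= ev3Xi ev3C ev3_beta (tnth_nth 0) /= sub0r.
rewrite /Defs.beta /Defs.alpha !expr1n !expr0n !gtn_eqF ?muln_gt0 ?q0_gt0 //.
rewrite mulr0 !add0r expr1n mulr1 => /eqP; rewrite oppr_eq0 => /eqP c0.
move: zE; rewrite c0 mul0r subr0 ev3Xi (tnth_nth 0) => /eqP.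
by rewrite (negPf z_neq0).
Qed.

(** A further relation [p] at the image point would divide, modulo the relations
    of the curve, its norm [c], so [c (z / beta) = 0]. *)
Lemma xi_endo : exists phi : {rmorphism K -> K}, [/\ forall c, phi (iota c) = iota c,
  phi x = alpha / beta, phi y = y / beta & phi z = z / beta].
Proof.
have C := xi_on_curve (pcharK k2 iota) (on_curveK hK) beta_neq0.
have [|phi phiE] := endo_of_point k2 hK C.
  move=> p p0; apply: contraTeq isT => /(norm_exists k2 hK)[p' [c [c0 pp']]].
  have : ev (p * p' - zpoly c) = 0 by rewrite rmorphB rmorphM /= pp' ev3_zpoly subrr.
  move=> /(ev_ker k2 hK)/(_ K iota _ _ _ C); rewrite rmorphB rmorphM /= p0 mul0r sub0r.
  rewrite ev3_zpoly => /eqP; rewrite oppr_eq0 => /eqP/t_transcendental/eqP.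
  by rewrite (negPf c0).
exists phi; split=> [c|||].
- by have := phiE c%:MP; rewrite !ev3C.
- by have := phiE 'X_i0; rewrite !ev3Xi !(tnth_nth 0).
- by have := phiE 'X_i1; rewrite !ev3Xi !(tnth_nth 0).
- by have := phiE 'X_i2; rewrite !ev3Xi !(tnth_nth 0).
Qed.

Lemma xi_exists : exists xi : curve_aut iota, is_xi q0 x y z xi.
Proof.
have [phi [phik px py pz]] := xi_endo; have b0 := beta_neq0.
have C := on_curveK hK; have K2 := pcharK k2 iota.
have phiphi f : [\/ f = x, f = y | f = z] -> phi (phi f) = f.
  case=> ->; rewrite ?px ?py ?pz fmorph_div /= ?rmorph_alpha rmorph_beta px py ?pz;
    rewrite ?(alpha_xi K2 C b0) (beta_xi K2 C b0) invrK divfK //.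
by have [s sE] := aut_of_endo hK phik phik phiphi phiphi; exists s; split; rewrite sE.
Qed.

Context (xi : curve_aut iota) (xiP : is_xi q0 x y z xi).

Lemma xi_beta : pullback xi beta = beta^-1.
Proof.
have [px py _] := xiP; rewrite rmorph_beta /= px py.
have C := on_curveK hK; have K2 := pcharK k2 iota; have b0 := beta_neq0.
exact (beta_xi K2 C b0).
Qed.

Lemma xi_alpha : pullback xi alpha = x / beta.
Proof.
have [px py _] := xiP; rewrite rmorph_alpha /= px py.
have C := on_curveK hK; have K2 := pcharK k2 iota; have b0 := beta_neq0.
exact (alpha_xi K2 C b0).
Qed.

Lemma xiK : (xi * xi = 1)%g.
Proof.
have [px py pz] := xiP; have b0 := beta_neq0.
by apply: (eq_aut hK) => /=; rewrite ?px ?py ?pz fmorph_div /= xi_beta ?xi_alpha ?py ?pz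
  invrK divfK.
Qed.

Lemma pullback_xiK f : pullback xi (pullback xi f) = f.
Proof. exact: (congr1 (fun s => pullback s f) xiK). Qed.

Lemma xi_actK P : aut_act xi (aut_act xi P) = P.
Proof. by rewrite -aut_actM xiK aut_act1. Qed.

End Involution.

(** * The places at the affine points *)

Section AffinePlace.
Context (n : nat) (k : closedFieldType) (k2 : 2%N \in [pchar k]).
Local Notation q0 := (2 ^ n)%N.
Local Notation q := (2 * q0 ^ 2)%N.
Local Notation m := (q - 2 * q0 + 1)%N.
Context (K : fieldType) (iota : {rmorphism k -> K}) (x y z : K).
Context (hK : is_function_field iota (affine_curve q0) (tnth [tuple x; y; z])).
Local Notation ev := (ev3 iota x y z).

Lemma z_neq_const c : z - iota c != 0.
Proof.
apply/eqP => zc; have : (map_poly iota ('X - c%:P)).[z] = 0.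
  by rewrite rmorphB /= map_polyX map_polyC hornerXsubC.
by move/(z_transcendental hK)/eqP; rewrite polyXsubC_eq0.
Qed.

Context (a b c : k) (C : on_curve n a b c).
Local Notation at_pt := (ev3 idfun a b c).
Local Notation t := (z - iota c).

Definition local_ring : set K :=
  [set h | exists p r, at_pt r != 0 /\ h = ev p / ev r].

Lemma at_pt_neq0 r : at_pt r != 0 -> ev r != 0.
Proof. by apply: contra_neq => /(ev_ker k2 hK)/(_ k idfun _ _ _ C). Qed.

Lemma local_ev p : local_ring (ev p).
Proof. by exists p, 1; rewrite !rmorph1 oner_eq0 divr1. Qed.

Lemma local_evV r : at_pt r != 0 -> local_ring (ev r)^-1.
Proof. by move=> r0; exists 1, r; rewrite rmorph1 div1r. Qed.

Lemma local_iota d : local_ring (iota d).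
Proof. by have := local_ev d%:MP; rewrite ev3C. Qed.

Lemma localB f g : local_ring f -> local_ring g -> local_ring (f - g).
Proof.
move=> [p [r [r0 ->]]] [p' [r' [r0' ->]]].
exists (p * r' - p' * r), (r * r'); split.
  by rewrite ev3M; exact: (mulf_neq0 r0 r0').
by rewrite ev3B !ev3M -[in LHS]mulNr addf_div ?at_pt_neq0 // mulNr.
Qed.

Lemma localM f g : local_ring f -> local_ring g -> local_ring (f * g).
Proof.
move=> [p [r [r0 ->]]] [p' [r' [r0' ->]]].
exists (p * p'), (r * r'); split.
  by rewrite ev3M; exact: (mulf_neq0 r0 r0').
by rewrite !ev3M mulf_div.
Qed.

Lemma local0 : local_ring 0.
Proof. by rewrite -(rmorph0 iota); exact: local_iota. Qed.

Lemma local1 : local_ring 1.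
Proof. by rewrite -(rmorph1 iota); exact: local_iota. Qed.

Lemma localD f g : local_ring f -> local_ring g -> local_ring (f + g).
Proof.
by move=> Of Og; rewrite -[g]opprK -[- g]sub0r; do !apply: localB => //; exact: local0.
Qed.

Lemma localX f i : local_ring f -> local_ring (f ^+ i).
Proof.
by move=> Of; elim: i => [|i IH]; [exact: local1|rewrite exprS; exact: localM].
Qed.

Lemma local_t : local_ring t.
Proof.
apply: localB; last exact: local_iota.
by have := local_ev 'X_i2; rewrite ev3Xi (tnth_nth 0).
Qed.

Definition value_mod_t (f : K) (v : k) : Prop :=
  local_ring f /\ exists2 h, local_ring h & f - iota v = t * h.

Lemma value_mod_tC d : value_mod_t (iota d) d.
Proof.
split; first exact: local_iota.
by exists 0; rewrite ?subrr ?mulr0 //; exact: local0.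
Qed.

Lemma value_mod_tD f g v w :
  value_mod_t f v -> value_mod_t g w -> value_mod_t (f + g) (v + w).
Proof.
move=> [Of [h Oh fE]] [Og [l Ol gE]]; split; first exact: localD.
exists (h + l); first exact: localD.
by rewrite mulrDr -fE -gE rmorphD opprD addrACA.
Qed.

Lemma value_mod_tM f g v w :
  value_mod_t f v -> value_mod_t g w -> value_mod_t (f * g) (v * w).
Proof.
move=> [Of [h Oh fE]] [Og [l Ol gE]]; split; first exact: localM.
exists (f * l + h * iota w).
  by apply: localD; apply: localM => //; exact: local_iota.
by rewrite mulrDr mulrCA -gE mulrA -fE rmorphM; ring.
Qed.

Lemma value_mod_tX f v i : value_mod_t f v -> value_mod_t (f ^+ i) (v ^+ i).
Proof.
move=> fv; elim: i => [|i IH]; first by have := value_mod_tC 1; rewrite rmorph1.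
by rewrite !exprS; exact: value_mod_tM.
Qed.

Lemma value_mod_tz : value_mod_t z c.
Proof.
split; last by exists 1; rewrite ?mulr1 //; exact: local1.
by rewrite -[z](subrK (iota c)); apply: localD; [exact: local_t|exact: local_iota].
Qed.

(** [f - v] divides [(f - v) ^ q + (f - v)] with a cofactor that is invertible
    in the local ring. *)
Lemma value_mod_t_AS p g w : value_mod_t g w ->
  (ev p - iota (at_pt p)) ^+ q + (ev p - iota (at_pt p)) = g - iota w ->
  value_mod_t (ev p) (at_pt p).
Proof.
move=> [_ [h Oh gE]] fE; split; first exact: local_ev.
pose r := 1 + (p - (at_pt p)%:MP) ^+ q.-1.
have q1 : (0 < q.-1)%N by rewrite -ltnS prednK ?q_gt1 // ltnW ?q_gt1.
have rE : ev r = 1 + (ev p - iota (at_pt p)) ^+ q.-1.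
  rewrite /r rmorphD rmorphXn rmorphB rmorph1 /=. by rewrite ev3C.
have r0 : at_pt r != 0.
  rewrite /r rmorphD rmorphXn rmorphB rmorph1 /= ev3C subrr expr0n gtn_eqF //.
  by rewrite addr0 oner_eq0.
exists (h / ev r); first by apply: localM => //; exact: local_evV.
rewrite mulrA -gE -fE; set u := ev p - _ in rE *.
have -> : u ^+ q + u = u * ev r.
  by rewrite rE mulrDr mulr1 -exprS prednK ?(ltnW (q_gt1 n)) // addrC.
by rewrite mulfK //; exact: at_pt_neq0.
Qed.

(** The coordinates [x] and [y] differ from [a] and [b] by multiples of [t]: the
    projection [z] is unramified over the affine line. *)
Lemma value_mod_tx : value_mod_t x a.
Proof.
have K2 := pcharK k2 iota.
have := @value_mod_t_AS 'X_i0 _ _ (value_mod_tX m value_mod_tz).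
rewrite !ev3Xi !(tnth_nth 0) /=; apply.
rewrite !(oppr_pchar2 K2) (expqD n K2) -C.2 -(on_curveK hK).2.
by rewrite rmorphD rmorphXn addrACA.
Qed.

Lemma value_mod_ty : value_mod_t y b.
Proof.
have K2 := pcharK k2 iota.
have := @value_mod_t_AS 'X_i1 _ _
  (value_mod_tM (value_mod_tX q0 value_mod_tx) (value_mod_tX m value_mod_tz)).
rewrite !ev3Xi !(tnth_nth 0) /=; apply.
rewrite !(oppr_pchar2 K2) (expqD n K2) -C.2 -(on_curveK hK).2 -C.1 -(on_curveK hK).1.
by rewrite rmorphD rmorphXn addrACA.
Qed.

Lemma value_mod_t_ev p : value_mod_t (ev p) (at_pt p).
Proof.
elim/mpolyind: p => [|d mm p _ _ IH].
  by rewrite !rmorph0; have := value_mod_tC 0; rewrite rmorph0.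
rewrite !rmorphD /= !ev3Z !ev3X; apply: value_mod_tD => //.
apply: value_mod_tM; first exact: value_mod_tC.
apply: value_mod_tM; first exact: value_mod_tX value_mod_tx.
apply: value_mod_tM; first exact: value_mod_tX value_mod_ty.
exact: value_mod_tX value_mod_tz.
Qed.

Definition local_unit (f : K) : Prop := [/\ f != 0, local_ring f & local_ring f^-1].

Lemma local_unitM f g : local_unit f -> local_unit g -> local_unit (f * g).
Proof.
by move=> [? ? ?] [? ? ?]; split; rewrite ?mulf_neq0 ?invfM //; exact: localM.
Qed.

Lemma local_unitV f : local_unit f -> local_unit f^-1.
Proof. by move=> [? ? ?]; split; rewrite ?invr_eq0 ?invrK. Qed.

Lemma local_unit_ev p : at_pt p != 0 -> local_unit (ev p).
Proof.
by move=> p0; split; [exact: at_pt_neq0|exact: local_ev|exact: local_evV].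
Qed.

Lemma local_unit_or_t f : local_ring f ->
  local_unit f \/ exists2 h, local_ring h & f = t * h.
Proof.
move=> [p [r [r0 ->]]]; have ur := local_unitV (local_unit_ev r0).
have [p0|p0] := eqVneq (at_pt p) 0; last first.
  by left; apply: local_unitM => //; exact: local_unit_ev.
right; have [_ [h Oh]] := value_mod_t_ev p; rewrite p0 rmorph0 subr0 => ->.
by exists (h / ev r); [apply: localM => //; case: ur|rewrite mulrA].
Qed.

(** Induction on [D]: an [f] that is not a unit is a multiple of [t], which cancels. *)
Lemma local_order_div D f g w : local_ring f -> local_ring g -> local_unit w ->
  f * g = t ^+ D * w -> exists i u, local_unit u /\ f = t ^+ i * u.
Proof.
elim: D f => [|D IH] f Of Og uw fg.
  exists 0%N, f; rewrite mul1r; split=> //.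
  have f0 : f != 0.
    by apply: contra_eq_neq fg => ->; rewrite mul0r mul1r eq_sym; case: uw.
  have fV : f^-1 = g * w^-1.
    by have [w0 _ _] := uw; rewrite -[w]mul1r -fg invfM mulrCA divff ?mulr1 //;
      apply: contra_eq_neq fg => ->; rewrite mulr0 mul1r eq_sym.
  by split=> //; rewrite fV; apply: localM => //; case: uw.
have [uf|[h Oh fE]] := local_unit_or_t Of.
  by exists 0%N, f; rewrite mul1r.
have [|i [u [uu hE]]] := IH h Oh Og uw.
  by apply: (mulfI (z_neq_const c)); rewrite mulrA -fE fg exprS mulrA.
by exists i.+1, u; split=> //; rewrite fE hE exprS mulrA.
Qed.

(** An element divides its norm to [k(z)], whose order at [c] is finite. *)
Lemma local_order p : ev p != 0 -> exists i u, local_unit u /\ ev p = t ^+ i * u.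
Proof.
move=> /(norm_exists k2 hK)[p' [d [d0 pp']]].
have [D [e /implyP/(_ d0) ec dE]] := multiplicity_XsubC d c.
apply: (@local_order_div D _ (ev p') (ev (zpoly e))); try exact: local_ev.
  by apply: local_unit_ev; rewrite ev3_zpoly map_poly_id.
rewrite pp' dE rmorphM rmorphXn rmorphB /= map_polyX map_polyC hornerM horner_exp.
by rewrite hornerXsubC ev3_zpoly mulrC.
Qed.

Lemma not_local_tV : ~ local_ring t^-1.
Proof.
move=> [p [r [r0 E1]]]; have t0 := z_neq_const c.
have : ev (r - p * ('X_i2 - c%:MP)) = 0.
  rewrite rmorphB rmorphM rmorphB /= ev3Xi ev3C (tnth_nth 0) /=.
  by rewrite -[ev p](divfK (at_pt_neq0 r0)) -E1 mulrAC mulVf // mul1r subrr.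
move=> /(ev_ker k2 hK)/(_ k idfun _ _ _ C).
rewrite rmorphB rmorphM rmorphB /= ev3Xi ev3C (tnth_nth 0) /= subrr mulr0 subr0.
by move/eqP; rewrite (negPf r0).
Qed.

Lemma local_ring_valuation : is_valuation_ring iota local_ring.
Proof.
split.
- split=> [|f g|f g]; rewrite !inE; [exact: local1|exact: localB|exact: localM].
- split=> [_ [d _ <-]|sub]; first exact: local_iota.
  have [d _ /eqP] := sub _ (value_mod_tz).1.
  by rewrite eq_sym -subr_eq0 (negPf (z_neq_const d)).
- by split=> // sub; apply: not_local_tV; exact: sub.
move=> f; have [p [r [r0 ->]]] := ev_frac hK f.
have [p0|p0] := eqVneq (ev p) 0; first by left; rewrite p0 mul0r; exact: local0.
have [i [u [uu ->]]] := local_order p0; have [l [w [uw ->]]] := local_order r0.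
have t0 := z_neq_const c.
have tX s : local_ring (t ^+ s) by apply: localX; exact: local_t.
have [u0 Ou Ou'] := uu; have [w0 Ow Ow'] := uw.
have [li|/ltnW il] := leqP l i.
  left; rewrite -(subnK li) exprD invfM; set tl := t ^+ l.
  have tl0 : tl != 0 by rewrite expf_neq0.
  have -> : t ^+ (i - l) * tl * u * (tl^-1 * w^-1) = t ^+ (i - l) * (u * w^-1).
    by field; rewrite tl0 w0.
  by apply: localM => //; exact: localM.
right; rewrite invf_div -(subnK il) exprD invfM; set ti := t ^+ i.
have ti0 : ti != 0 by rewrite expf_neq0.
have -> : t ^+ (l - i) * ti * w * (ti^-1 * u^-1) = t ^+ (l - i) * (w * u^-1).
  by field; rewrite ti0 u0.
by apply: localM => //; exact: localM.
Qed.

Definition affine_place : place iota := Place local_ring_valuation.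

Lemma affine_place_value :
  [/\ has_value x affine_place a, has_value y affine_place b
    & has_value z affine_place c].
Proof.
have vt : vanishes t affine_place.
  by split; [exact: local_t|right; exact: not_local_tV].
have val f v : value_mod_t f v -> has_value f affine_place v.
  by move=> [_ [h Oh fE]]; rewrite /has_value fE; exact: vanishesMr.
by split; apply: val; [exact: value_mod_tx|exact: value_mod_ty|exact: value_mod_tz].
Qed.

(** A valuation ring is maximal for domination: a place with the same values
    contains the local ring, and contains no inverse of a non-unit of it. *)
Lemma affine_place_uniq (P : place iota) :
  has_value x P a -> has_value y P b -> has_value z P c -> P = affine_place.
Proof.
move=> xa yb zc; have val p : has_value (ev p) P (at_pt p).
  rewrite ev3_id; apply: value_mpoly => i; rewrite !(tnth_nth 0).
  by case: (ord3P i) => ->.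
have sub f : local_ring f -> regular_at P f.
  by move=> [p [r [r0 ->]]]; exact: value_regular (value_div r0 (val p) (val r)).
apply: place_eq; apply/seteqP; split=> f; last exact: sub.
move=> Pf; have [//|] := regular_or_inv affine_place f.
move=> [p [r [r0 fE]]]; have [p0|p0] := eqVneq (at_pt p) 0; last first.
  rewrite -[f]invrK fE invf_div; apply: localM; first exact: local_ev.
  exact: local_evV.
have [->|f0] := eqVneq f 0; first exact: local0.
have := value_div r0 (val p) (val r); rewrite -fE p0 mul0r => /value0 vf.
by have := vanishesMr vf Pf; rewrite mulVf // => /not_vanishes1.
Qed.

End AffinePlace.

(** * The pole of x *)

Lemma add_pow_div (K : fieldType) (f : K) i : f != 0 -> (0 < i)%N ->
  (f ^+ i + f) / f ^+ i = 1 + f^-1 ^+ i.-1.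
Proof.
case: i => // i f0 _; rewrite mulrDl divff ?expf_neq0 //; congr (_ + _).
by rewrite exprS invfM mulrA divff // mul1r exprVn.
Qed.

Section Pole.
Context (n : nat) (k : closedFieldType) (k2 : 2%N \in [pchar k]).
Local Notation q0 := (2 ^ n)%N.
Local Notation q := (2 * q0 ^ 2)%N.
Local Notation m := (q - 2 * q0 + 1)%N.
Context (K : fieldType) (iota : {rmorphism k -> K}) (x y z : K).
Context (hK : is_function_field iota (affine_curve q0) (tnth [tuple x; y; z])).
Local Notation alpha := (alpha q0 x y).
Local Notation beta := (beta q0 x y).
Implicit Types P Q : place iota.

(** The equations make [g] and [h] integral over [k[f]]. *)
Lemma curve_regular P f g h : on_curve n f g h -> regular_at P f ->
  regular_at P g /\ regular_at P h.
Proof.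
move=> [gE hE] Of; split; last first.
  by apply: (@regular_expI _ _ _ _ _ m); rewrite ?m_gt0 // -hE; apply: regularD => //; exact: regularX.
apply: contrapT => pg; have q1 := q_gt1 n; have g0 := pole_neq0 pg.
have Og' := poleV pg; apply: (@not_vanishes1 _ _ _ P).
have -> : 1 = (g ^+ q + g) * g^-1 ^+ q - g^-1 ^+ q.-1.
  by rewrite [g^-1 ^+ q]exprVn add_pow_div ?(ltnW q1) // addrK.
apply: vanishesB; last by apply: vanishesX => //; rewrite -ltnS prednK // ltnW.
apply: vanishesMl; last by apply: vanishesX => //; exact: ltnW.
rewrite gE; apply: regularM; first exact: regularX.
by apply: regularD => //; exact: regularX.
Qed.

Lemma regular_beta P : regular_at P x -> regular_at P y ->
  regular_at P alpha /\ regular_at P beta.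
Proof.
move=> Ox Oy; have Oa : regular_at P alpha by apply: regularD; exact: regularX.
by split=> //; apply: regularD; [apply: regularM => //|]; exact: regularX.
Qed.

(** Near a pole of [x], the dominant terms of the equations give successively
    [z ^ m ~ x ^ q], [y ^ q ~ x ^ (q + q0)] and [beta ^ q ~ x ^ q * y ^ (2 q0)],
    whence [beta ^ (q ^ 2) ~ z ^ (q ^ 2 + 1)]. *)
Lemma beta_at_pole P : has_pole x P ->
  has_pole beta P /\ has_value (beta ^+ (q ^ 2) / z ^+ (q ^ 2 + 1)) P 1.
Proof.
move=> px; have [C1 C2] := on_curveK hK; have K2 := pcharK k2 iota.
have x0 := pole_neq0 px; have q1 := q_gt1 n; have z0 := z_neq0 hK.
have q01 := q0_gt0 n.
have vr := poleV px; have zm0 : z ^+ m != 0 by rewrite expf_neq0.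
have qm : (0 < q.-1)%N by rewrite -ltnS prednK // ltnW.
have inv1 f : has_pole f P -> has_value ((f ^+ q + f) / f ^+ q) P 1.
  move=> pf; have f0 := pole_neq0 pf.
  rewrite add_pow_div ?(ltnW q1) //.
  rewrite -[X in has_value _ _ X]addr0; apply: valueD; first exact: value1.
  by apply/value0/vanishesX => //; exact: poleV.
have tx : has_value (z ^+ m / x ^+ q) P 1 by rewrite -C2; exact: inv1.
have py : has_pole y P.
  move=> Oy; suff /value0/(value_uniq tx)/eqP : vanishes (z ^+ m / x ^+ q) P.
    by rewrite oner_eq0.
  have -> : z ^+ m / x ^+ q = (y ^+ q + y) * x^-1 ^+ (q0 + q).
    rewrite C1 C2 [x^-1 ^+ _]exprD !exprVn; field; by rewrite !expf_neq0.
  apply: vanishesMl; first by apply: regularD => //; exact: regularX.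
  by apply: vanishesX => //; rewrite addn_gt0 q0_gt0.
have y0 := pole_neq0 py; have vy := poleV py.
have xy : has_value (x ^+ (q0 + q) / y ^+ q) P 1.
  have := value_div (oner_neq0 k) (inv1 _ py) tx; rewrite C1 C2 divr1.
  rewrite (_ : _ / _ / _ = x ^+ (q0 + q) / y ^+ q) // [x ^+ (q0 + q)]exprD.
  by field; rewrite !expf_neq0.
have vxy : vanishes (x / y) P.
  have vq : vanishes ((x / y) ^+ q) P.
    have -> : (x / y) ^+ q = (x ^+ (q0 + q) / y ^+ q) * x^-1 ^+ q0.
      by rewrite exprVn [x ^+ (q0 + q)]exprD expr_div_n; field; rewrite !expf_neq0.
    by apply: vanishesMl; [exact: value_regular xy|exact: vanishesX].
  apply: (vanishes_expI _ vq); apply: (@regular_expI _ _ _ _ _ q); first exact: ltnW.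
  exact: vanishes_regular vq.
(* [y ^ 2] and [x ^ (2 q0 + 2)] are of lower order than [x ^ q * y ^ (2 q0)]. *)
have bq : has_value (beta ^+ q / (x ^+ q * y ^+ (2 * q0))) P 1.
  have -> : beta ^+ q / (x ^+ q * y ^+ (2 * q0))
      = 1 + (y^-1 ^+ (2 * q0 - 2) * x^-1 ^+ q + (x / y) ^+ (2 * q0) * x^-1 ^+ (q - 2)).
    have -> : beta ^+ q = x ^+ q * y ^+ (2 * q0) + y ^+ 2 + x ^+ (2 * q0) * x ^+ 2.
      rewrite (beta_q K2 (on_curveK hK)) (betaE K2 (on_curveK hK)) (xq K2 (on_curveK hK)).
      by rewrite !expr2q0; ring.
    have yE : y ^+ (2 * q0) = y ^+ (2 * q0 - 2) * y ^+ 2.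
      by rewrite -exprD subnK // leq_pmulr.
    have xE : x ^+ q = x ^+ (q - 2) * x ^+ 2 by rewrite -exprD subnK.
    rewrite !exprVn expr_div_n !mulrDl divff ?mulf_neq0 ?expf_neq0 // -addrA.
    congr (_ + (_ + _)); last first.
      rewrite [in LHS]xE; set u := x ^+ (2 * q0); set v := y ^+ (2 * q0).
      have v0 : v != 0 by rewrite expf_neq0.
      by field; rewrite v0 x0 expf_neq0.
    rewrite yE; set v := y ^+ (2 * q0 - 2).
    have v0 : v != 0 by rewrite expf_neq0.
    by field; rewrite v0 y0 expf_neq0.
  rewrite -[X in has_value _ _ X]addr0; apply: valueD; first exact: value1.
  apply/value0/vanishesD.
    apply: vanishesMl; first by apply: regularX; exact: vanishes_regular.
    by apply: vanishesX => //; exact: ltnW.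
  apply: vanishesMr; first by apply: vanishesX => //; rewrite muln_gt0.
  by apply: regularX; exact: vanishes_regular.
split.
  move=> Ob; suff /value0/(value_uniq bq)/eqP :
    vanishes (beta ^+ q / (x ^+ q * y ^+ (2 * q0))) P by rewrite oner_eq0.
  rewrite invfM mulrA -!exprVn; apply: vanishesMr.
    apply: vanishesMl; first exact: regularX.
    by apply: vanishesX => //; exact: ltnW.
  by apply: regularX; exact: vanishes_regular.
have := valueM (valueX q bq) (valueM (valueX (2 * q0) (valueV (oner_neq0 k) xy))
   (valueX (q + 2 * q0 + 1) (valueV (oner_neq0 k) tx))).
rewrite invr1 !expr1n !mulr1 !invf_div; congr has_value.
rewrite !expr_div_n exprMn -mM [z ^+ (m * _)]exprM.
have -> : beta ^+ (q ^ 2) = (beta ^+ q) ^+ q by rewrite -exprM mulnn.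
rewrite [(y ^+ (2 * q0)) ^+ q]exprAC.
have -> : (x ^+ q) ^+ (q + 2 * q0 + 1) = (x ^+ q) ^+ q * (x ^+ (q0 + q)) ^+ (2 * q0).
  by rewrite -!exprM -exprD; congr (_ ^+ _); rewrite -mulnn; ring.
by field; rewrite !expf_neq0.
Qed.

Context (xi : curve_aut iota) (xiP : is_xi q0 x y z xi).

Lemma on_curve0 : on_curve n 0 0 (0 : k).
Proof.
have q1 := ltnW (q_gt1 n).
by rewrite /on_curve !expr0n !gtn_eqF ?m_gt0 ?q0_gt0 ?(q_gt1 n) //= addr0 mul0r.
Qed.

Definition P2 : place iota := affine_place k2 hK on_curve0.
Definition P1 : place iota := aut_act xi P2.

Lemma xi_P1 : aut_act xi P1 = P2.
Proof. exact: (xi_actK k2 hK xiP P2). Qed.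

Lemma P2_vanishes : [/\ vanishes x P2, vanishes y P2 & vanishes z P2].
Proof. by have [/value0 ? /value0 ? /value0 ?] := affine_place_value k2 hK on_curve0. Qed.

Lemma P2_uniq P : vanishes x P -> vanishes y P -> vanishes z P -> P = P2.
Proof. by move=> ? ? ?; apply: affine_place_uniq; apply/value0. Qed.

Lemma P2_beta : vanishes beta P2.
Proof.
have [vx vy vz] := P2_vanishes.
rewrite (betaE (pcharK k2 iota) (on_curveK hK)).
apply: vanishesD; first apply: vanishesD.
- by apply: vanishesMr => //; do !apply: regularX; exact: vanishes_regular.
- exact: vanishesX.
- by apply: vanishesMl; [do !apply: regularX; exact: vanishes_regular|exact: vanishesX].
Qed.

(** If [alpha / beta] were regular at the origin, then by [curve_regular] so would be
    [1 / beta], which is a polynomial in the coordinates of [xi]. *)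
Lemma P1_pole : has_pole x P1.
Proof.
have [px py pz] := xiP.
have K2 := pcharK k2 iota; have C := on_curveK hK; have b0 := beta_neq0 k2 hK.
rewrite /P1 aut_pole px => Ox.
have [Oy _] := curve_regular (xi_on_curve K2 C b0) Ox.
have vb := P2_beta.
apply: (vanishes_inv b0 vb); rewrite -(beta_xi K2 C b0).
have Oa : regular_at P2 (Defs.alpha q0 (alpha / beta) (y / beta)).
  by apply: regularD; exact: regularX.
by apply: regularD; [apply: regularM => //|]; exact: regularX.
Qed.

(** The argument of [beta_eq0], in the residue ring of [P]. *)
Lemma beta_vanishes P : regular_at P x -> vanishes beta P -> P = P2.
Proof.
move=> Ox vb; have K2 := pcharK k2 iota; have C := on_curveK hK.
have [Oy Oz] := curve_regular C Ox; have [Oa Ob] := regular_beta Ox Oy.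
have q01 := q0_gt0 n; have OX := regularX q0 Ox; have OY := regularX q0 Oy.
have va : vanishes alpha P.
  have vq : vanishes (alpha + x ^+ q0 * y) P.
    by rewrite -(beta_q0 K2 C); exact: vanishesX.
  have : vanishes ((alpha ^+ q0) ^+ 2 * alpha) P.
    have -> : (alpha ^+ q0) ^+ 2 * alpha
        = x * (alpha + x ^+ q0 * y) ^+ 2 - (y ^+ q0) ^+ 2 * beta.
      by rewrite -(x_beta_2q0 K2 C) (alpha_q0 K2 C) addrAC subrr add0r.
    apply: vanishesB; apply: vanishesMl => //; [exact: vanishesX|exact: regularX].
  by rewrite -exprM -exprSr; exact: vanishes_expI.
have vxy : vanishes (x ^+ q0 * y) P.
  have -> : x ^+ q0 * y = beta ^+ q0 - alpha by rewrite (beta_q0 K2 C) addrAC subrr add0r.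
  by apply: vanishesB => //; exact: vanishesX.
have yE : y = alpha ^+ q0 - x ^+ q0 * x by rewrite (alpha_q0 K2 C) addrK.
have vx : vanishes x P.
  case: (vanishes_prime OX Oy vxy) => [|vy]; first exact: vanishes_expI.
  apply: (@vanishes_expI _ _ _ _ _ q0.+1) => //.
  have -> : x ^+ q0.+1 = alpha ^+ q0 - y by rewrite (alpha_q0 K2 C) addrAC subrr add0r exprSr.
  by apply: vanishesB => //; exact: vanishesX.
have vy : vanishes y P.
  by rewrite yE; apply: vanishesB; [exact: vanishesX|exact: vanishesMl].
apply: P2_uniq => //; apply: (@vanishes_expI _ _ _ _ _ m) => //.
rewrite -C.2; apply: vanishesD => //; apply: vanishesX => //; exact: ltnW (q_gt1 n).
Qed.

(** If [x] has a pole at both [P] and [xi P], then so has [beta], although [xi]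
    maps it to its inverse. So [x] is regular at [xi P], where [beta] vanishes. *)
Lemma pole_x P : has_pole x P <-> P = P1.
Proof.
split=> [pxP|->]; last exact: P1_pole.
have [px py pz] := xiP; pose Q := aut_act xi P.
have PE : P = aut_act xi Q by rewrite (xi_actK k2 hK xiP).
rewrite PE /P1; congr aut_act; have [Ox|pxQ] := pselect (regular_at Q x).
  apply: beta_vanishes => //; have [Oy Oz] := curve_regular (on_curveK hK) Ox.
  have [Oa Ob] := regular_beta Ox Oy; apply: vanishesV => // Ob'.
  by move: pxP; rewrite PE aut_pole px; apply; exact: regularM.
have [pbP _] := beta_at_pole pxP; have [pbQ _] := beta_at_pole pxQ.
exfalso; move: pbP; rewrite PE aut_pole (xi_beta k2 hK xiP); apply.
exact: vanishes_regular (poleV pbQ).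
Qed.

End Pole.

(** * The two groups and the divisor *)

Section Groups.
Context (n : nat) (k : closedFieldType) (k2 : 2%N \in [pchar k]).
Local Notation q0 := (2 ^ n)%N.
Local Notation q := (2 * q0 ^ 2)%N.
Local Notation m := (q - 2 * q0 + 1)%N.
Context (K : fieldType) (iota : {rmorphism k -> K}) (x y z : K).
Context (hK : is_function_field iota (affine_curve q0) (tnth [tuple x; y; z])).
Local Notation G1 := (group_G1 iota q0 x y z).
Local Notation alpha := (alpha q0 x y).
Local Notation beta := (beta q0 x y).
Implicit Types P Q : place iota.

Lemma G1_range : G1 = range (g1 k2 hK).
Proof.
apply/seteqP; split=> s; first by move=> /(g1_surj k2 hK)[i ->]; exists i.
by move=> [i _ <-]; exact: g1_in.
Qed.

Lemma card_G1 : G1 #= `I_(q ^ 2).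
Proof.
pose f (i : 'I_#|{: 'I_q * 'I_q}|) := g1 k2 hK (enum_val i).
have -> : G1 = range f.
  rewrite G1_range; apply/seteqP; split=> _ [i _ <-]; last by exists (enum_val i).
  by exists (enum_rank i); rewrite /f ?enum_rankK.
have cardE : #|{: 'I_q * 'I_q}| = (q ^ 2)%N by rewrite card_prod card_ord.
rewrite -cardE; apply: card_eq_trans (card_esym card_II).
by apply: inj_card_eq => i j _ _ /g1_inj/enum_val_inj.
Qed.

Context (xi : curve_aut iota) (xiP : is_xi q0 x y z xi).
Local Notation P1 := (P1 k2 hK xi).
Local Notation P2 := (P2 k2 hK).
Local Notation G2 := [set (xi * s * xi^-1)%g | s in G1].

Lemma xiV : (xi^-1 = xi)%g.
Proof. by apply: (mulgI xi); rewrite mulgV (xiK k2 hK xiP). Qed.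

Lemma pullback_conj s f :
  pullback (xi * s * xi^-1)%g f = pullback xi (pullback s (pullback xi f)).
Proof. by rewrite xiV. Qed.

Lemma act_conj_P1 s : aut_act (xi * s * xi^-1)%g P1 = aut_act xi (aut_act s P2).
Proof. by rewrite xiV !aut_actM (xi_P1 k2 hK xiP). Qed.

Lemma G1_fixes_P1 s : G1 s -> aut_act s P1 = P1.
Proof.
move=> [a [b [_ sx _ _]]]; apply/(pole_x k2 hK xiP); rewrite aut_pole sx => Ox.
apply: (P1_pole xiP).
by have := regularB Ox (regular_iota _ a); rewrite addrK.
Qed.

Lemma G2_fixes_P2 s : G2 s -> aut_act s P2 = P2.
Proof.
move=> [t Gt <-]; rewrite xiV !aut_actM -[aut_act xi P2]/P1 (G1_fixes_P1 Gt).
exact: (xi_P1 k2 hK xiP).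
Qed.

Lemma G1_P2_value s a b : pullback s x = x + iota a ->
    pullback s y = y + iota (a ^+ q0) * x + iota b -> pullback s z = z ->
  [/\ has_value x (aut_act s P2) a, has_value y (aut_act s P2) b
    & has_value z (aut_act s P2) 0].
Proof.
move=> sx sy sz; have [/value0 vx /value0 vy /value0 vz] := P2_vanishes k2 hK.
split; apply/aut_value; rewrite ?sx ?sy ?sz //.
  by rewrite -[a]add0r; apply: valueD => //; rewrite add0r; exact: value_iota.
rewrite -[b]add0r; apply: valueD; last by rewrite add0r; exact: value_iota.
rewrite -[0]addr0 -{2}(mulr0 (a ^+ q0)); apply: valueD => //.
by apply: valueM => //; exact: value_iota.
Qed.

Lemma G1_P2_inj s t : G1 s -> G1 t -> aut_act s P2 = aut_act t P2 -> s = t.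
Proof.
move=> Gs Gt st; have [a [b [_ sx sy sz]]] := Gs; have [c [d [_ tx ty tz]]] := Gt.
have [va vb _] := G1_P2_value sx sy sz; have [vc vd _] := G1_P2_value tx ty tz.
rewrite st in va vb; have ac := value_uniq va vc; have bd := value_uniq vb vd.
by apply: (G1_inj hK Gs Gt); rewrite ?sx ?tx ?sy ?ty ac ?bd.
Qed.

(** [G1] fixes the only pole of [x], so [G2] fixes [P2 = xi P1], but in [G1] only the
    identity fixes [P2]. *)
Lemma G1_G2_trivial : G1 `&` G2 = [set 1%g].
Proof.
apply/seteqP; split=> [s [Gs /G2_fixes_P2 sP2]|_ ->].
  by apply: (G1_P2_inj Gs (G1_one n iota x y z)); rewrite aut_act1.
split; first exact: G1_one.
by exists 1%g; [exact: G1_one|rewrite mulg1 mulgV].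
Qed.

Lemma invariants_G2 : invariants G2 = [set pullback xi f | f in invariants G1].
Proof.
apply/seteqP; split=> [f fG|_ [f fG <-] _ [s Gs <-]].
  exists (pullback xi f); last exact: (pullback_xiK k2 hK xiP).
  move=> s Gs; rewrite -[RHS](congr1 (pullback xi) (fG _ (imageP _ Gs))).
  by rewrite pullback_conj (pullback_xiK k2 hK xiP).
by rewrite pullback_conj (pullback_xiK k2 hK xiP) fG.
Qed.

Lemma quotient_G2 : quotient_is_P1 G2.
Proof.
have [phi [phik phiG]] := quotient_G1 k2 hK.
exists (pullback xi \o phi : {rmorphism _ -> _}); split=> [c|] /=.
  by rewrite phik pullback_iota.
by rewrite invariants_G2 -phiG -image_comp.
Qed.

(** ** The points rational over the field with [q] elements *)

Definition rational_point P : Prop := exists a b, [/\ a ^+ q = a, b ^+ q = b,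
  has_value x P a, has_value y P b & has_value z P 0].

Definition Omega : set (place iota) := [set P | P = P1 \/ rational_point P].

Lemma on_curve_rational (a b : k) : a ^+ q = a -> b ^+ q = b -> on_curve n a b 0.
Proof.
move=> aq bq; have := translate_on_curve k2 aq bq (on_curve0 n k).
by rewrite mulr0 !add0r.
Qed.

Lemma rational_orbit P : rational_point P <-> exists2 s, G1 s & aut_act s P2 = P.
Proof.
split=> [[a [b [aq bq va vb v0]]]|[s [a [b [[aq bq] sx sy sz]]] <-]].
  have [s [sx sy sz]] := translation_exists k2 hK aq bq.
  exists s; first by exists a, b.
  have [va' vb' v0'] := G1_P2_value sx sy sz; have C := on_curve_rational aq bq.
  by rewrite (affine_place_uniq k2 hK C va' vb' v0') (affine_place_uniq k2 hK C va vb v0).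
by exists a, b; have [? ? ?] := G1_P2_value sx sy sz.
Qed.

Lemma not_rational_P1 : ~ rational_point P1.
Proof.
by move=> [a [b [_ _ /value_regular Ox _ _]]]; exact: (P1_pole xiP Ox).
Qed.

(** [xi] maps the rational affine point [(a, b, 0)] other than the origin to
    [(alpha / beta, b / beta, 0)], whose coordinates are rational too. *)
Lemma xi_Omega P : Omega P -> Omega (aut_act xi P).
Proof.
have [px py pz] := xiP; have [/value0 vx /value0 vy /value0 vz] := P2_vanishes k2 hK.
case=> [->|[a [b [aq bq va vb v0]]]].
  have q1 := ltnW (q_gt1 n); right; rewrite (xi_P1 k2 hK xiP); exists 0, 0.
  by split=> //; rewrite expr0n gtn_eqF.
have C := on_curve_rational aq bq.
have [bab0|bab0] := eqVneq (Defs.beta q0 a b) 0.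
  have [a0 b0 _] := beta_eq0 k2 C bab0; left; rewrite a0 in va; rewrite b0 in vb.
  by congr aut_act; apply: (P2_uniq k2 hK); exact/value0.
have valpha : has_value alpha P (Defs.alpha q0 a b) by apply: valueD; exact: valueX.
have vbeta : has_value beta P (Defs.beta q0 a b).
  by apply: valueD; [apply: valueM => //|]; exact: valueX.
right; exists (Defs.alpha q0 a b / Defs.beta q0 a b), (b / Defs.beta q0 a b).
have z0 : (0 : k) ^+ m = 0 by rewrite expr0n gtn_eqF ?m_gt0.
rewrite !expr_div_n (alpha_q k2 C) (beta_q k2 C) bq z0 !mul0r !addr0.
split=> //; apply/aut_value; rewrite ?px ?py ?pz; [exact: value_div|exact: value_div|].
by rewrite -(mul0r (Defs.beta q0 a b)^-1); exact: value_div.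
Qed.

Lemma orbit_P2 : [set aut_act s P2 | s in G1] = Omega `\ P1.
Proof.
apply/seteqP; split=> P [].
  move=> s Gs sP; have rP : rational_point P by apply/rational_orbit; exists s.
  by split; [right|move=> /= PE; apply: not_rational_P1; rewrite -PE].
by case=> [//|/rational_orbit[s Gs <-] _]; exists s.
Qed.

Lemma orbit_P1 : [set aut_act t P1 | t in G2] = Omega `\ P2.
Proof.
have xiact := xi_actK k2 hK xiP.
have xiO P : Omega P <-> Omega (aut_act xi P).
  by split=> [/xi_Omega//|/xi_Omega]; rewrite xiact.
have -> : [set aut_act t P1 | t in G2]
    = [set aut_act xi P | P in [set aut_act s P2 | s in G1]].
  apply/seteqP; split=> [_ [_ [s Gs <-] <-]|_ [_ [s Gs <-] <-]].
    by rewrite act_conj_P1; exists (aut_act s P2) => //; exists s.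
  by exists (xi * s * xi^-1)%g; [exists s|rewrite act_conj_P1].
rewrite orbit_P2; apply/seteqP; split=> P.
  move=> [Q [OQ QP1] <-]; split; first exact: xi_Omega.
  by move=> /= QP2; apply: QP1; rewrite /= -[Q]xiact QP2.
move=> [OP PP2]; exists (aut_act xi P); last exact: xiact.
split; first exact: xi_Omega.
by move=> /= PE; apply: PP2; rewrite /= -[P]xiact PE (xi_P1 k2 hK xiP).
Qed.

Lemma finite_G1 : finite_set G1.
Proof. by apply/finite_setP; exists (q ^ 2)%N; exact: card_G1. Qed.

(** Both divisors are the sum of all points of [Omega]. *)
Lemma divisor_eq :
  point_divisor P1 + \sum_(s \in G1) point_divisor (aut_act s P2)
  = point_divisor P2 + \sum_(t \in G2) point_divisor (aut_act t P1).
Proof.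
rewrite -(fsbig_image G1 (fun s => aut_act s P2) (@point_divisor k K iota)); last first.
  by move=> s t /set_mem Gs /set_mem Gt; exact: G1_P2_inj.
rewrite -(fsbig_image G2 (fun t => aut_act t P1) (@point_divisor k K iota)); last first.
  move=> _ _ /set_mem[s Gs <-] /set_mem[t Gt <-]; rewrite !act_conj_P1.
  move=> /(congr1 (aut_act xi)); rewrite !(xi_actK k2 hK xiP) => st.
  by rewrite (G1_P2_inj Gs Gt st).
have finO : finite_set Omega.
  have -> : Omega = P1 |` (Omega `\ P1).
    apply/seteqP; split=> P; first by have [->|?] := pselect (P = P1); [left|right].
    by case=> [->|[]] //; left.
  by rewrite -orbit_P2 finite_setU; split=> //; apply: finite_image; exact: finite_G1.
have OP1 : Omega P1 by left.
have OP2 : Omega P2.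
  by right; apply/rational_orbit; exists 1%g; [exact: G1_one|exact: aut_act1].
rewrite orbit_P2 orbit_P1.
by rewrite -(fsbigD1 P1 Omega _ finO OP1) -(fsbigD1 P2 Omega _ finO OP2).
Qed.

End Groups.

(** * The minimal polynomial of beta over k(z) *)

Section Bounds.
Context (k : closedFieldType) (K : fieldType) (iota : {rmorphism k -> K}).
Context (P : place iota).

Lemma value_coef_prod_XsubC (rs : seq (K * k)) :
    (forall r, r \in rs -> has_value r.1 P r.2) ->
  forall i, has_value (\prod_(r <- rs) ('X - r.1%:P))`_i P
                      (\prod_(r <- rs) ('X - r.2%:P))`_i.
Proof.
elim: rs => [|r rs IH] rv i.
  rewrite !big_nil !coef1; case: (i == 0%N); first exact: value1.
  exact/value0/vanishes0.
have IH' := IH (fun r' hr' => rv _ (mem_behead (s := _ :: _) hr')).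
rewrite !big_cons !mulrBl !coefB !coefXM !coefCM.
apply: valueB; first by case: (i == 0%N); [exact/value0/vanishes0|exact: IH'].
by apply: valueM => //; apply: rv; exact: mem_head.
Qed.

(** In characteristic two the coefficients of [\prod ('X - r)] raised to the
    power [2 ^ e] are the elementary symmetric functions of the [r ^ (2 ^ e)], each of
    which is [w] times a regular element. *)
Lemma regular_coef_prod_XsubC e (w : K) (rs : seq K) : 2%N \in [pchar K] -> w != 0 ->
    (forall r, r \in rs -> regular_at P (r ^+ (2 ^ e) / w)) ->
  forall i, (i <= size rs)%N -> regular_at P
    ((\prod_(r <- rs) ('X - r%:P))`_i ^+ (2 ^ e) / w ^+ (size rs - i)).
Proof.
move=> K2 w0; have e0 : (0 < 2 ^ e)%N by rewrite expn_gt0.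
elim: rs => [|r rs IH] rv i; rewrite ?leqn0 => /= ile.
  by rewrite big_nil coef1 (eqP ile) expr1n expr0 divr1; exact: regular1.
have {}IH := IH (fun r' hr' => rv _ (mem_behead (s := _ :: _) hr')).
have rw := rv r (mem_head _ _); set p := \prod_(r <- rs) _ in IH.
have pbig : p`_(size rs).+1 = 0 by rewrite nth_default // size_prod_XsubC.
rewrite big_cons mulrBl coefB coefXM coefCM (oppr_pchar2 K2) exp2nD // mulrDl.
apply: regularD.
  case: i ile => [|i] ile /=; last by rewrite subSS; exact: IH.
  by rewrite expr0n gtn_eqF // mul0r; exact: regular0.
have [ile'|] := leqP i (size rs); last first.
  move=> ilt; have -> : i = (size rs).+1 by apply/eqP; rewrite eqn_leq ile.
  by rewrite pbig mulr0 expr0n gtn_eqF // mul0r; exact: regular0.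
rewrite subSn // exprS invfM exprMn mulrACA; apply: regularM => //; exact: IH.
Qed.

(** After division by the leading power of [f], the lower terms are constants times
    positive powers of [1 / f], which vanish. *)
Lemma poly_at_pole (f : K) (p : {poly k}) : has_pole f P -> p != 0 ->
  has_value ((map_poly iota p).[f] / f ^+ (size p).-1) P (lead_coef p).
Proof.
move=> pf p0; have f0 := pole_neq0 pf; have vf := poleV pf.
rewrite (@horner_coef_wide _ (size p)) ?size_map_poly // mulr_suml.
have sp : size p = (size p).-1.+1 by rewrite prednK // size_poly_gt0.
have -> : lead_coef p = \sum_(i < size p) p`_i * 0 ^+ ((size p).-1 - i).
  rewrite sp big_ord_recr /= subnn expr0 mulr1 big1 ?add0r // => i _.
  by rewrite expr0n gtn_eqF ?mulr0 // subn_gt0.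
apply: value_sum => i; rewrite coef_map.
have -> : iota p`_i * f ^+ i / f ^+ (size p).-1 = iota p`_i * f^-1 ^+ ((size p).-1 - i).
  have ip : (i <= (size p).-1)%N by rewrite -ltnS -sp.
  by rewrite -{1}(subnK ip) exprD exprVn; field; rewrite !expf_neq0.
by apply: valueM; [exact: value_iota|apply: valueX; exact/value0].
Qed.

End Bounds.

Section BetaPolynomial.
Context (n : nat) (k : closedFieldType) (k2 : 2%N \in [pchar k]).
Local Notation q0 := (2 ^ n)%N.
Local Notation q := (2 * q0 ^ 2)%N.
Local Notation m := (q - 2 * q0 + 1)%N.
Context (K : fieldType) (iota : {rmorphism k -> K}) (x y z : K).
Context (hK : is_function_field iota (affine_curve q0) (tnth [tuple x; y; z])).
Local Notation ev := (ev3 iota x y z).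
Local Notation beta := (beta q0 x y).
Local Notation M := (q ^ 2)%N.
Context (xi : curve_aut iota) (xiP : is_xi q0 x y z xi).
Local Notation P1 := (P1 k2 hK xi).
Local Notation P2 := (P2 k2 hK).
Local Notation chi := (chi k2 hK).
Local Notation g := (g1 k2 hK).
Context (c : nat -> {poly k}).
Context (cE : forall i, (chi beta)`_i = (map_poly iota (c i)).[z]).

Lemma M_gt1 : (1 < M)%N.
Proof. by have := q_gt1 n; rewrite -(ltn_exp2r 1 q (e := 2)) // exp1n. Qed.

Lemma z_pole : has_pole z P1.
Proof.
move=> Oz; have px := P1_pole (k2 := k2) (hK := hK) xiP; have q1 := q_gt1 n.
apply: (@not_vanishes1 _ _ _ P1).
have x0 : x != 0 by exact: pole_neq0 px.
have -> : 1 = z ^+ m * x^-1 ^+ q - x^-1 ^+ q.-1.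
  rewrite [x^-1 ^+ q]exprVn -(on_curveK hK).2 add_pow_div ?addrK //; exact: ltnW.
apply: vanishesB.
  apply: vanishesMl; first exact: regularX.
  by apply: vanishesX; [exact: ltnW|exact: poleV].
by apply: vanishesX; [rewrite -ltnS prednK // ltnW|exact: poleV].
Qed.

Lemma conj_beta_at_P1 i : has_value (pullback (g i) beta ^+ M / z ^+ (M + 1)) P1 1.
Proof.
have Gi := g1_in k2 hK i; have [a [b [_ _ _ gz]]] := Gi.
have [_ vb] := beta_at_pole k2 hK (P1_pole (k2 := k2) (hK := hK) xiP).
have -> : pullback (g i) beta ^+ M / z ^+ (M + 1)
    = pullback (g i) (beta ^+ M / z ^+ (M + 1)).
  by rewrite fmorph_div !rmorphXn /= gz.
by apply/(aut_value (g i) _ P1); rewrite (G1_fixes_P1 k2 hK xiP Gi).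
Qed.

Lemma chi_seq : chi beta = \prod_(r <- [seq pullback (g i) beta | i : 'I_q * 'I_q]) ('X - r%:P).
Proof. by rewrite big_image. Qed.

Lemma size_conj : size [seq pullback (g i) beta | i : 'I_q * 'I_q] = M.
Proof. by rewrite size_map -cardE card_prod card_ord mulnn. Qed.

(** The [M - i]-th elementary symmetric function of the conjugates, each of which has
    at [P1] the order of [z ^ ((M + 1) / M)]. *)
Lemma c_regular i : (i <= M)%N ->
  regular_at P1 ((map_poly iota (c i)).[z] ^+ M / (z ^+ (M + 1)) ^+ (M - i)).
Proof.
have w0 : z ^+ (M + 1) != 0 by rewrite expf_neq0 ?(z_neq0 hK).
have ME : M = (2 ^ ((n + n).+1 * 2))%N by rewrite q_pow2 -expnM.
have := @regular_coef_prod_XsubC _ _ _ P1 ((n + n).+1 * 2) _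
  [seq pullback (g i) beta | i : 'I_q * 'I_q] (pcharK k2 iota) w0 _ i.
rewrite -ME size_conj -chi_seq cE => reg iM; apply: reg => // r /mapP[j _ ->].
exact: value_regular (conj_beta_at_P1 j).
Qed.

(** By [poly_at_pole] the pole order of [(c i)(z)] at [P1] is [deg (c i)] times that of
    [z], and [c_regular] bounds it. *)
Lemma c_lead_bound i : (i <= M)%N -> c i != 0 ->
  ((size (c i)).-1 * M <= (M - i) * (M + 1))%N.
Proof.
move=> iM ci0; rewrite leqNgt; apply/negP => lt.
have pz := z_pole; have z0 := z_neq0 hK.
have /(valueX M) v := poly_at_pole pz ci0.
suff /value0/(value_uniq v)/eqP :
    vanishes (((map_poly iota (c i)).[z] / z ^+ (size (c i)).-1) ^+ M) P1.
  by rewrite expf_eq0 lead_coef_eq0 (negPf ci0) andbF.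
set N := (size (c i)).-1 in lt *.
have -> : ((map_poly iota (c i)).[z] / z ^+ N) ^+ M
    = ((map_poly iota (c i)).[z] ^+ M / (z ^+ (M + 1)) ^+ (M - i))
      * z^-1 ^+ (N * M - (M - i) * (M + 1)).
  rewrite expr_div_n; have -> : (z ^+ N) ^+ M
      = (z ^+ (M + 1)) ^+ (M - i) * z ^+ (N * M - (M - i) * (M + 1)).
    by rewrite -!exprM -exprD [((M + 1) * _)%N]mulnC subnKC // ltnW.
  by rewrite exprVn invfM mulrA.
apply: vanishesMl; first exact: c_regular.
by apply: vanishesX; [rewrite subn_gt0|exact: poleV].
Qed.

(** The previous bound is [deg (c i) <= M - i + (M - i) / M], and the fraction is
    less than [1] unless [i = 0]. *)
Lemma size_c i : (0 < i)%N -> (size (c i) <= M.+1 - i)%N.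
Proof.
move=> i0; have M1 := M_gt1; have [iM|Mi] := leqP i M.
  have [->|ci0] := eqVneq (c i) 0; first by rewrite size_poly0.
  have := c_lead_bound iM ci0; have : (0 < size (c i))%N by rewrite size_poly_gt0.
  case: (size (c i)) => // N _ /=; rewrite subSn // ltnS; set e := (M - i)%N => le.
  have eM : (e < M)%N by rewrite /e ltn_subrL i0 ltnW.
  rewrite leqNgt; apply/negP => eN; move: le; rewrite leqNgt => /negP; apply.
  apply: leq_trans (leq_mul eN (leqnn M)); rewrite mulnDr muln1 mulSn addnC ltn_add2r.
  exact: eM.
suff -> : c i = 0 by rewrite size_poly0.
by apply: (z_transcendental hK); rewrite -cE nth_default // size_chi.
Qed.

Lemma size_c0 : (size (c 0) <= M.+2)%N.
Proof.
have [->|c0] := eqVneq (c 0%N) 0; first by rewrite size_poly0.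
have := c_lead_bound (leq0n M) c0; rewrite subn0 mulnC leq_pmul2l; last first.
  exact: ltnW M_gt1.
by rewrite addn1; case: (size (c 0)).
Qed.

Lemma c_M : c M = 1.
Proof.
apply/eqP; rewrite -subr_eq0; apply/eqP/(z_transcendental hK).
rewrite rmorphB rmorph1 hornerD hornerN hornerC -cE.
have /monicP := chi_monic k2 hK beta; rewrite /lead_coef size_chi /= => ->.
by rewrite subrr.
Qed.

(** The norm of [beta] has the pole order of [z ^ (M + 1)] at [P1]. *)
Lemma c0_lead : (c 0%N)`_(M.+1) != 0.
Proof.
have K2 := pcharK k2 iota; have pz := z_pole; have z0 := z_neq0 hK.
have v : has_value ((map_poly iota (c 0%N)).[z] ^+ M / z ^+ (M.+1 * M)) P1 1.
  rewrite -cE -horner_coef0 horner_prod -prodrXl exprM.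
  have -> : (z ^+ M.+1) ^+ M = \prod_(i : 'I_q * 'I_q) (z ^+ M.+1).
    by rewrite prodr_const card_prod card_ord mulnn.
  rewrite -prodf_div; have -> : 1 = \prod_(i : 'I_q * 'I_q) (1 : k) by rewrite big1.
  apply: value_prod => i; rewrite hornerXsubC sub0r (oppr_pchar2 K2) -(addn1 M).
  exact: conj_beta_at_P1.
have c0 : c 0%N != 0.
  apply/eqP => c0; move: v; rewrite c0 rmorph0 horner0 expr0n gtn_eqF ?mul0r ?(ltnW M_gt1) //.
  by move/value_uniq/(_ ((value0 _ _).2 (vanishes0 _)))/eqP; rewrite oner_eq0.
have := size_c0; rewrite leq_eqVlt => /orP[/eqP sc|].
  by have := lead_coef_eq0 (c 0%N); rewrite /lead_coef sc /= => ->.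
rewrite ltnS => sc; have /(valueX M) v' := poly_at_pole pz c0.
suff /value0/(value_uniq v)/eqP :
    vanishes ((map_poly iota (c 0%N)).[z] ^+ M / z ^+ (M.+1 * M)) P1.
  by rewrite oner_eq0.
set N := (size (c 0%N)).-1 in v'.
have NM : (N < M.+1)%N by rewrite /N prednK // size_poly_gt0.
have -> : (map_poly iota (c 0%N)).[z] ^+ M / z ^+ (M.+1 * M)
    = ((map_poly iota (c 0%N)).[z] / z ^+ N) ^+ M * z^-1 ^+ ((M.+1 - N) * M).
  rewrite expr_div_n -exprM exprVn -mulrA -invfM -exprD -mulnDl subnKC //.
  exact: ltnW.
apply: vanishesMl; first exact: value_regular v'.
by apply: vanishesX; [rewrite muln_gt0 subn_gt0 NM ltnW ?M_gt1|exact: poleV].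
Qed.

Lemma value_range (a b d : k) (C : on_curve n a b d) f :
  range ev f -> exists v, has_value f (affine_place k2 hK C) v.
Proof.
move=> [p _ <-]; exists (p.@[tnth [tuple a; b; d]]); apply: value_mpoly => i.
have [? ? ?] := affine_place_value k2 hK C.
by rewrite !(tnth_nth 0); case: (ord3P i) => ->.
Qed.

Lemma beta_range : range ev beta.
Proof. by exists (beta_poly n k) => //; rewrite ev3_beta. Qed.

(** Specialising [chi beta] at a point above [z = d] gives its coefficients at [d] on
    the one hand, and its roots on the other. *)
Lemma chi_at_point (a b d : k) (C : on_curve n a b d) :
  exists v : 'I_q * 'I_q -> k,
    (forall i, has_value (pullback (g i) beta) (affine_place k2 hK C) (v i)) /\
    forall j, (\prod_i ('X - (v i)%:P))`_j = (c j).[d].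
Proof.
have vP i : exists v, has_value (pullback (g i) beta) (affine_place k2 hK C) v.
  by apply: value_range; have [p _ <-] := beta_range; exact: G1_ev (g1_in k2 hK i).
pose v i := sval (cid (vP i)); have vE i := svalP (cid (vP i)).
exists v; split=> // j; set P := affine_place _ _ _ in vE *.
have vchi : has_value (chi beta)`_j P (\prod_i ('X - (v i)%:P))`_j.
  have := @value_coef_prod_XsubC _ _ _ P
    [seq (pullback (g i) beta, v i) | i : 'I_q * 'I_q] _ j.
  by rewrite !big_image /=; apply=> r /mapP[i _ ->] /=; exact: vE.
apply: (value_uniq vchi); rewrite cE.
have [_ _ vz] := affine_place_value k2 hK C.
have := @value_mpoly _ _ _ P 3 (tnth [tuple x; y; z]) (tnth [tuple a; b; d]) (zpoly (c j)).
rewrite -[X in has_value X]/(ev3 iota x y z (zpoly (c j))) ev3_zpoly.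
rewrite -ev3_id ev3_zpoly map_poly_id //.
have [? ? ?] := affine_place_value k2 hK C.
by apply=> i; rewrite !(tnth_nth 0); case: (ord3P i) => ->.
Qed.

(** At [P2] the conjugates of [beta] take their values at the points [(a, b, 0)], of
    which exactly one, that for the identity, vanishes. *)
Lemma c1_0 : (c 1%N)`_0 != 0.
Proof.
have [v [vE vc]] := chi_at_point (on_curve0 n k).
rewrite -horner_coef0 -vc; have [i0 gi0] := g1_surj k2 hK (G1_one n iota x y z).
have vi0 i : v i = 0 -> i = i0.
  move=> vi; have := vE i; rewrite vi -/P2 => /value0/aut_vanishes vb.
  apply: (@g1_inj _ _ k2 _ _ _ _ _ hK); rewrite -gi0.
  apply: (G1_P2_inj (k2 := k2) (hK := hK) (g1_in k2 hK i) (G1_one n iota x y z)).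
  rewrite aut_act1; apply: beta_vanishes vb.
  have [a [b [_ gx gy gz]]] := g1_in k2 hK i.
  by have [/value_regular] := G1_P2_value k2 hK gx gy gz.
have v0 : v i0 = 0.
  apply: (value_uniq (vE i0)); rewrite -gi0 /= -/P2.
  exact/value0/P2_beta.
rewrite (bigD1 i0) //= v0 subr0 coefXM /= -horner_coef0 horner_prod.
apply/prodf_neq0 => i ii0; rewrite hornerXsubC sub0r oppr_eq0.
by apply: contra_neq ii0; exact: vi0.
Qed.

End BetaPolynomial.

(** * The plane curve *)

Section HomogeneousPolynomial.
Context (k : fieldType) (d : nat) (c : nat -> {poly k}).

Definition monomial3 (i l : nat) : 'X_{1..3} :=
  [multinom tnth [tuple (d - i - l)%N; i; l] j | j < 3].

(** The homogenisation of [\sum_(i < d) (c i)(Z) Y ^ i] to degree [d]; the condition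
    [i + l <= d] keeps the exponent of [X] from being truncated. *)
Definition homogenization : {mpoly k[3]} :=
  \sum_(i < d) \sum_(l < d.+1 | (i + l <= d)%N) (c i)`_l *: 'X_[monomial3 i l].

Lemma mdeg_monomial3 i l : (i + l <= d)%N -> mdeg (monomial3 i l) = d.
Proof.
by move=> ild; rewrite mdegE big_ord3 !mnmE !(tnth_nth 0%N) /=; lia.
Qed.

Lemma homogenization_homog : homogenization \is d.-homog.
Proof.
apply: rpred_sum => i _; apply: rpred_sum => l ild; apply: dhomogZ.
by rewrite dhomogX /= mdeg_monomial3.
Qed.

Section Eval.
Context (L : comNzRingType) (j : {rmorphism k -> L}).

Lemma ev3_homog e (a u v w : L) (p : {mpoly k[3]}) : p \is e.-homog ->
  ev3 j (a * u) (a * v) (a * w) p = a ^+ e * ev3 j u v w p.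
Proof.
move=> /dhomogP pe; rewrite [p]mpolyE !rmorph_sum mulr_sumr /=.
rewrite !big_seq; apply: eq_bigr => mm /pe; rewrite /= mdegE big_ord3 => <-.
by rewrite !ev3Z !ev3X !exprMn !exprD; ring.
Qed.

Context (size_ci : forall i, (0 < i)%N -> (size (c i) <= d - i)%N).
Context (size_c0 : (size (c 0) <= d.+1)%N).

Lemma ev3_homogenization (b w : L) :
  ev3 j 1 b w homogenization = \sum_(i < d) (map_poly j (c i)).[w] * b ^+ i.
Proof.
rewrite /homogenization rmorph_sum; apply: eq_bigr => i _.
have szi : (size (c i) <= d.+1)%N.
  by case: (posnP i) => [->//|/size_ci/leq_trans]; apply; lia.
rewrite (@horner_coef_wide _ d.+1) ?(leq_trans (size_poly _ _)) // mulr_suml /=.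
rewrite rmorph_sum /= big_mkcond; apply: eq_bigr => l _.
rewrite coef_map ev3Z ev3X expr1n mul1r !mnmE !(tnth_nth 0%N) /=.
case: ifP => [_|/negbT ild]; first by rewrite [b ^+ _ * _]mulrC mulrA.
rewrite nth_default ?rmorph0 ?mul0r //; case: (posnP i) => [i0|/size_ci/leq_trans].
  by move: ild (ltn_ord l); rewrite i0; lia.
by apply; lia.
Qed.

(** On the line [X = 0] only the top coefficient of [c 0] survives. *)
Lemma ev3_homogenization0 (b w : L) : (0 < d)%N ->
  ev3 j 0 b w homogenization = j (c 0%N)`_d * w ^+ d.
Proof.
move=> d0; rewrite /homogenization rmorph_sum (bigD1 (Ordinal d0)) //=.
have term0 (i : 'I_d) (l : 'I_d.+1) : (i + l <= d)%N ->
    (nat_of_ord i, nat_of_ord l) != (0%N, d) ->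
    ev3 j 0 b w ((c i)`_l *: 'X_[monomial3 i l]) = 0.
  move=> ild ne; rewrite ev3Z ev3X !mnmE !(tnth_nth 0%N) /=.
  have [lt|ge] := ltnP (i + l) d.
    by rewrite expr0n gtn_eqF ?mul0r ?mulr0 // subn_gt0; lia.
  have i0 : (0 < i)%N by move: ne; rewrite xpair_eqE negb_and; lia.
  by rewrite nth_default ?rmorph0 ?mul0r // (leq_trans (size_ci i0)) //; lia.
rewrite [X in _ + X]big1 => [|i i0]; last first.
  rewrite rmorph_sum big1 // => l ild; apply: term0 => //.
  by rewrite -val_eqE /= in i0; rewrite xpair_eqE (negPf i0).
rewrite addr0 rmorph_sum (bigD1 ord_max) //= big1 => [|l /andP[ild ld]]; last first.
  exact: (term0 (Ordinal d0)).
rewrite addr0 ev3Z ev3X !mnmE !(tnth_nth 0%N) /= subn0 subnn !expr0.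
by rewrite !mul1r.
Qed.

End Eval.

Lemma meval_mderiv_homogenization (s : 'I_3) (v : 'I_3 -> k) :
  (mderiv s homogenization).@[v] =
  \sum_(i < d) \sum_(l < d.+1 | (i + l <= d)%N) (c i)`_l *
    ((monomial3 i l s)%:R * (v i0 ^+ (d - i - l - (s == i0)) *
      (v i1 ^+ (i - (s == i1)) * v i2 ^+ (l - (s == i2))))).
Proof.
rewrite /homogenization (raddf_sum (mderiv s)) (raddf_sum (meval v)) /=.
apply: eq_bigr => i _; rewrite (raddf_sum (mderiv s)) (raddf_sum (meval v)) /=.
apply: eq_bigr => l _.
rewrite mderivZ mderivX !mevalZ mevalX big_ord3.
by rewrite !mnmBE !mnm1E !mnmE !(tnth_nth 0%N).
Qed.

(** Only the monomial [X Y ^ (d - 1)] has a non-zero derivative there. *)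
Lemma mderiv0_homogenization : (0 < d)%N ->
  (mderiv i0 homogenization).@[tnth [tuple 0; 1; 0]] = (c d.-1)`_0.
Proof.
move=> d0; have d1 : (d.-1 < d)%N by rewrite prednK.
rewrite meval_mderiv_homogenization (bigD1 (Ordinal d1)) //= (bigD1 ord0) /=; last first.
  by rewrite addn0 ltnW.
rewrite big1 => [|l /andP[ild l0]]; last first.
  rewrite !(tnth_nth 0) /= !subn0 [0 ^+ l]expr0n.
  by rewrite -val_eqE /= in l0; rewrite (negPf l0) !mulr0.
rewrite big1 => [|i id1]; last first.
  rewrite big1 // => l ild; rewrite !(tnth_nth 0) /= !subn0.
  have [l0|l0] := posnP l; last by rewrite [0 ^+ l]expr0n gtn_eqF // !mulr0.
  rewrite -val_eqE /= in id1; rewrite l0 expr0n gtn_eqF ?mul0r ?mulr0 //.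
  by rewrite !subn0 subn_gt0 ltn_subRL; have := ltn_ord i; lia.
rewrite !(tnth_nth 0) /= !mnmE !(tnth_nth 0%N) /= !subn0 expr1n mulr1 !addr0.
have -> : (d - d.-1 = 1)%N by lia.
by rewrite subnn !expr0 !mulr1.
Qed.

(** Only the monomial [X ^ (d - 1) Y] has a non-zero derivative there. *)
Lemma mderiv1_homogenization : (1 < d)%N ->
  (mderiv i1 homogenization).@[tnth [tuple 1; 0; 0]] = (c 1%N)`_0.
Proof.
move=> d1; rewrite meval_mderiv_homogenization (bigD1 (Ordinal d1)) //=.
rewrite (bigD1 ord0) /=; last by rewrite addn0 ltnW.
rewrite big1 => [|l /andP[ild l0]]; last first.
  rewrite !(tnth_nth 0) /= !subn0 [0 ^+ l]expr0n.
  by rewrite -val_eqE /= in l0; rewrite (negPf l0) !mulr0.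
rewrite big1 => [|i id1]; last first.
  rewrite big1 // => l ild; rewrite !(tnth_nth 0) /= !mnmE !(tnth_nth 0%N) /=.
  have [->|i0] := posnP i; first by rewrite mul0r mulr0.
  rewrite -val_eqE /= in id1; rewrite [0 ^+ (i - 1)]expr0n gtn_eqF ?mul0r ?mulr0 //.
  by rewrite subn_gt0; lia.
rewrite !(tnth_nth 0) /= !mnmE !(tnth_nth 0%N) /= !subn0 expr1n subnn !expr0.
by rewrite !mulr1 addr0 addr0.
Qed.

End HomogeneousPolynomial.

(** ** Irreducibility *)

Section Grading.
Context (k : fieldType).

Local Notation ppp := {poly {poly {poly k}}}.

Definition const3 : {rmorphism k -> ppp} := polyC \o (polyC \o polyC).

(** The substitution [X := w, Y := w T, Z := w S] into [k[S][T][w]]; the power of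
    [w] records the degree. *)
Definition grading : {mpoly k[3]} -> ppp :=
  ev3 const3 'X ('X * 'X%:P) ('X * 'X%:P%:P).

HB.instance Definition _ := GRing.RMorphism.copy grading
  (ev3 const3 'X ('X * 'X%:P) ('X * 'X%:P%:P)).

Lemma grading_monomial m : grading 'X_[m]
  = (('X^(m i2))%:P * 'X^(m i1))%:P * 'X^(m i0 + m i1 + m i2).
Proof.
rewrite /grading ev3X !polyCM !polyC_exp !exprD !exprMn.
move: 'X 'X%:P 'X%:P%:P => a b c; ring.
Qed.

Lemma gradingD p p' : grading (p + p') = grading p + grading p'.
Proof. exact: rmorphD. Qed.

Lemma gradingM p p' : grading (p * p') = grading p * grading p'.
Proof. exact: rmorphM. Qed.

Lemma gradingZ e p : grading (e *: p) = e%:P%:P%:P * grading p.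
Proof. exact: ev3Z. Qed.

Lemma grading_coef p (m : 'X_{1..3}) :
  ((grading p)`_(m i0 + m i1 + m i2))`_(m i1)`_(m i2) = p@_m.
Proof.
elim/mpolyind: p => [|e m' p _ _ IH].
  have -> : grading 0 = 0 by exact: rmorph0.
  by rewrite !coef0 mcoeff0.
rewrite gradingD gradingZ grading_monomial mcoeffD mcoeffZ mcoeffX.
move: (grading p) IH => G IH; rewrite !coefD IH; congr (_ + _).
rewrite !coefCM coefXn.
have [<-|ne] := eqVneq m' m.
  by rewrite eqxx mulr1 coefCM coefXn eqxx mulr1 coefXn eqxx.
have [e0|ne0] := eqVneq (m i0 + m i1 + m i2)%N (m' i0 + m' i1 + m' i2)%N; last first.
  by rewrite mulr0 !coef0.
rewrite mulr1 coefCM coefXn.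
have [e1|ne1] := eqVneq (m i1) (m' i1); last by rewrite mulr0 coef0.
rewrite mulr1 coefXn; have [e2|ne2] := eqVneq (m i2) (m' i2); last by [].
case/eqP: ne; apply/mnmP => i; case: (ord3P i) => ->; lia.
Qed.

Lemma grading_inj : injective grading.
Proof.
move=> p p' pp'; apply/mpolyP => m.
by rewrite -!grading_coef pp'.
Qed.

Lemma grading_homogenization d (c : nat -> {poly k}) :
    (forall i, (0 < i)%N -> (size (c i) <= d - i)%N) -> (size (c 0) <= d.+1)%N ->
  grading (homogenization d c) = (\sum_(i < d) (c i)%:P * 'X^i)%:P * 'X^d.
Proof.
move=> szi sz0; have -> : grading (homogenization d c)
    = ev3 const3 ('X * 1) ('X * 'X%:P) ('X * 'X%:P%:P) (homogenization d c).
  by rewrite mulr1.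
rewrite (ev3_homog _ _ _ _ _ (homogenization_homog d c)) ev3_homogenization //.
rewrite mulrC; congr (_ * _); rewrite rmorph_sum; apply: eq_bigr => i _.
rewrite /= polyCM polyC_exp; congr (_ * _).
rewrite /const3 map_poly_comp map_poly_comp !horner_map /=; congr (_%:P%:P).
by have := comp_polyXr (c i).
Qed.

Lemma grading_unit A e i : grading A = e%:P%:P%:P * 'X^i ->
  ev3 idfun 0 0 1 A != 0 -> A \is a GRing.unit.
Proof.
move=> gA A1; have AE : A = e *: 'X_i0 ^+ i.
  apply: grading_inj; rewrite gA gradingZ; congr (_ * _).
  have -> : grading ('X_i0 ^+ i) = grading 'X_i0 ^+ i by exact: rmorphXn.
  by congr (_ ^+ _); rewrite /grading ev3Xi.
move: A1; rewrite AE ev3Z rmorphXn /= ev3Xi (tnth_nth 0) /= mulf_eq0 negb_or.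
rewrite expf_eq0 eqxx andbT -leqNgt leqn0 => /andP[e0 /eqP ->].
apply/unitrPr; exists (e^-1 *: 1).
by rewrite expr0 -scalerAl mul1r scalerA divff // scale1r.
Qed.

(** The factors of [homogenization d c] are mapped to monomials in [w], whose
    coefficients factor the affine equation; one of these is constant, so the
    corresponding factor is [e X ^ i], and [X] does not divide the polynomial. *)
Lemma homogenization_irreducible d (c : nat -> {poly k}) :
    (forall i, (0 < i)%N -> (size (c i) <= d - i)%N) -> (size (c 0) <= d.+1)%N ->
    (0 < d)%N -> (c 0%N)`_d != 0 ->
    (forall a b, a * b = \sum_(i < d) (c i)%:P * 'X^i ->
      (exists e, a = e%:P%:P) \/ (exists e, b = e%:P%:P)) ->
  irreducible_mpoly (homogenization d c).
Proof.
move=> szi sz0 d0 cd irr; set F := homogenization d c; set N := \sum_(i < d) _ in irr.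
have F1 : ev3 idfun 0 0 1 F != 0.
  by rewrite ev3_homogenization0 // expr1n mulr1.
have F0 : F != 0 by apply: contra_neq F1 => ->; exact: rmorph0.
have gF : grading F = N%:P * 'X^d by exact: grading_homogenization.
have N0 : N != 0.
  apply: contra_neq F0 => N0; apply: grading_inj; rewrite gF N0 mul0r.
  exact/esym/rmorph0.
split=> //.
  apply/negP => /mulrV /(congr1 (ev3 idfun 0 1 0)).
  rewrite ev3M ev3_homogenization0 // expr0n gtn_eqF // mulr0 mul0r rmorph1.
  by move/eqP; rewrite eq_sym oner_eq0.
move=> A B FAB; have AB1 : ev3 idfun 0 0 1 A != 0 /\ ev3 idfun 0 0 1 B != 0.
  by apply/andP; rewrite -negb_or -mulf_eq0 -ev3M -FAB.
have gAB : grading A * grading B = N%:P * 'X^d by rewrite -gradingM -FAB.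
have [a [i gA]] := monomial_factor N0 gAB.
have [b [l gB]] := monomial_factor N0 (etrans (mulrC _ _) gAB).
have /irr : a * b = N.
  move/(congr1 (fun p => p.[1])): gAB; rewrite gA gB !hornerM !hornerC !hornerXn.
  by rewrite !expr1n !mulr1.
case=> -[e E1]; [left|right].
  by rewrite E1 in gA; exact: grading_unit gA AB1.1.
by rewrite E1 in gB; exact: grading_unit gB AB1.2.
Qed.

End Grading.

(** * The plane model and its Galois points *)

Lemma rmorph_on_curve n (K L : fieldType) (phi : {rmorphism K -> L}) x y z :
  on_curve n x y z -> on_curve n (phi x) (phi y) (phi z).
Proof.
by move=> [C1 C2]; split; rewrite -!rmorphXn -!rmorphD -?rmorphM ?C1 ?C2.
Qed.

Section PlaneModel.
Context (n : nat) (k : closedFieldType) (k2 : 2%N \in [pchar k]).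
Local Notation q0 := (2 ^ n)%N.
Local Notation q := (2 * q0 ^ 2)%N.
Local Notation m := (q - 2 * q0 + 1)%N.
Context (K : fieldType) (iota : {rmorphism k -> K}) (x y z : K).
Context (hK : is_function_field iota (affine_curve q0) (tnth [tuple x; y; z])).
Local Notation G1 := (group_G1 iota q0 x y z).
Local Notation beta := (beta q0 x y).
Local Notation M := (q ^ 2)%N.
Local Notation chi := (chi k2 hK).
Local Notation g := (g1 k2 hK).

Lemma beta_z_generate (L : set K) : subextension iota L -> L beta -> L z -> L = setT.
Proof.
move=> sL Lb Lz; have z0 := z_neq0 hK; have [LB LV kL] := (subextensionP _ _).1 sL.
have K2 := pcharK k2 iota; have C := on_curveK hK.
have LX f i : L f -> L (f ^+ i) by move=> Lf; exact: (subextensionX _ sL Lf).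
have LD f f' : L f -> L f' -> L (f + f') by exact: (subextensionD sL).
have LM f f' : L f -> L f' -> L (f * f') by exact: (subextensionM sL).
have Lw : L ((beta ^+ q + beta) / z ^+ m) by apply: (LV); [apply: (LD) => //|]; exact: (LX).
have Lx : L x.
  rewrite (x_of_beta_z K2 C z0); apply: (LD); last exact: (LX).
  by apply: (LV); [apply: (LD); [exact: (LX)|exact: Lw]|do 2!apply: (LX)].
have Ly : L y.
  rewrite (y_of_beta_z K2 C z0); apply: (LD); first exact: (LX).
  by apply: (LM); exact: (LX).
apply/seteqP; split=> // f _; have : [set: K] f by [].
by rewrite -(gen_xyz hK); apply: adjoin_min => // _ [] ->.
Qed.

(** The conjugations fix [z], and [z] and [beta] generate [K]. *)
Lemma conj_beta_inj : injective (fun i => pullback (g i) beta).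
Proof.
move=> i j ij; have K2 := pcharK k2 iota; apply: (@g1_inj _ _ k2 _ _ _ _ _ hK).
have gz s : G1 s -> pullback s z = z by move=> [? [? []]].
have z0 := z_neq0 hK; have gi := g1_in k2 hK i; have gj := g1_in k2 hK j.
have Ci := rmorph_on_curve (pullback (g i)) (on_curveK hK).
have Cj := rmorph_on_curve (pullback (g j)) (on_curveK hK).
rewrite /= (gz _ gi) in Ci; rewrite /= (gz _ gj) in Cj.
have bi := rmorph_beta (pullback (g i)) q0 x y.
have bj := rmorph_beta (pullback (g j)) q0 x y.
rewrite /= in bi bj.
have xij : pullback (g i) x = pullback (g j) x.
  by rewrite (x_of_beta_z K2 Ci z0) (x_of_beta_z K2 Cj z0) -bi -bj ij.
apply: (G1_inj hK gi gj) => //.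
by rewrite (y_of_beta_z K2 Ci z0) (y_of_beta_z K2 Cj z0) -bi -bj ij xij.
Qed.

Section MinimalPolynomial.
Context (c : nat -> {poly k}).
Context (cE : forall i, (chi beta)`_i = (map_poly iota (c i)).[z]).
Local Notation zm := (z_morphism iota z).
Local Notation N := (\sum_(i < M.+1) (c i)%:P * 'X^i).

Lemma z_morphism_inj : injective zm.
Proof.
move=> p p' /eqP; rewrite -subr_eq0 -rmorphB => /eqP/(z_transcendental hK)/eqP.
by rewrite subr_eq0 => /eqP.
Qed.

Lemma map_N : map_poly zm N = chi beta.
Proof.
rewrite rmorph_sum -[RHS]coefK size_chi poly_def; apply: eq_bigr => i _.
by rewrite rmorphM rmorphXn /= map_polyX map_polyC /= mul_polyC cE.
Qed.

(** A factor of which [beta] is a root has all the [M] conjugates as roots. *)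
Lemma chi_beta_factor (a b : {poly {poly k}}) : a * b = N ->
  (map_poly zm a).[beta] = 0 -> exists e, b = e%:P%:P.
Proof.
move=> abN a0; have chi0 : chi beta != 0 by rewrite monic_neq0 ?chi_monic.
have ab : map_poly zm a * map_poly zm b = chi beta by rewrite -rmorphM /= abN map_N.
have ne : (map_poly zm a != 0) && (map_poly zm b != 0).
  by rewrite -negb_or -mulf_eq0 ab.
have [az0 bz0] := andP ne.
have roots : all (root (map_poly zm a)) [seq pullback (g i) beta | i : 'I_q * 'I_q].
  apply/allP => _ /mapP[i _ ->]; have [d [e [_ _ _ gz]]] := g1_in k2 hK i.
  rewrite /root; have -> : map_poly zm a = map_poly (pullback (g i)) (map_poly zm a).
    rewrite -map_poly_comp; apply: eq_map_poly => p /=.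
    rewrite /z_morphism -horner_map -map_poly_comp /= gz; congr (_.[_]).
    by apply: eq_map_poly => s /=; rewrite pullback_iota.
  by rewrite horner_map a0 rmorph0.
have := max_poly_roots az0 roots; rewrite map_inj_uniq ?enum_uniq; last exact: conj_beta_inj.
rewrite size_conj => /(_ isT) Ma.
have szb : size (map_poly zm b) = 1%N.
  have := size_mul az0 bz0; rewrite ab size_chi.
  rewrite -size_poly_gt0 in bz0; move: bz0 Ma.
  by move: M (size _) (size _) => u v w; lia.
have /eqP/size_poly1P[b1 b10 bE] : size b = 1%N.
  by rewrite -szb size_map_inj_poly ?rmorph0 //; exact: z_morphism_inj.
have : lead_coef a * b1 = 1.
  apply: z_morphism_inj; rewrite rmorph1.
  have /monicP := chi_monic k2 hK beta; rewrite -ab lead_coefM => <-.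
  rewrite rmorphM /= bE map_polyC lead_coefC; congr (_ * _).
  by rewrite lead_coef_map_inj ?rmorph0 //; exact: z_morphism_inj.
move=> ab1; have /size_poly1P[e _ eE] : size b1 == 1%N.
  have : size (lead_coef a * b1) = 1%N by rewrite ab1 size_poly1.
  have la0 : lead_coef a != 0.
    by apply: contra_eq_neq ab1 => ->; rewrite mul0r eq_sym oner_eq0.
  rewrite size_mul //; rewrite -size_poly_gt0 in la0; rewrite -size_poly_gt0 in b10.
  by move: la0 b10; move: (size b1) (size _) => u v; lia.
by exists e; rewrite bE eE.
Qed.

(** The conjugates of [beta] are distinct, so [chi beta] is its minimal polynomial
    over [k(z)]; it is monic, hence irreducible over [k[z]]. *)
Lemma chi_beta_irreducible (a b : {poly {poly k}}) : a * b = N ->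
  (exists e, a = e%:P%:P) \/ (exists e, b = e%:P%:P).
Proof.
move=> abN; have : (map_poly zm N).[beta] = 0.
  by rewrite map_N; apply/eqP; exact: chi_root.
rewrite -abN rmorphM hornerM => /eqP; rewrite mulf_eq0 => /orP[] /eqP r0.
  by right; exact: chi_beta_factor abN r0.
by left; apply: chi_beta_factor r0; rewrite mulrC.
Qed.

End MinimalPolynomial.

(** ** Galois points *)

Lemma is_galois_G1 : is_galois iota (invariants G1).
Proof.
split=> [h|]; last first.
  apply/seteqP; split=> f fG s; last by move=> /(_ f fG).
  by move=> Gs; apply: fG => l; exact.
exists (chi h); split; first by rewrite monic_neq0 ?chi_monic.
  by move=> i; exact: chi_coef_inv.
exact: chi_root.
Qed.

Context (xi : curve_aut iota) (xiP : is_xi q0 x y z xi).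
Local Notation G2 := [set (xi * s * xi^-1)%g | s in G1].

Lemma is_galois_G2 : is_galois iota (invariants G2).
Proof.
split=> [h|]; last first.
  apply/seteqP; split=> f fG s; last by move=> /(_ f fG).
  by move=> Gs; apply: fG => l; exact.
exists (map_poly (pullback xi) (chi (pullback xi h))); split.
- by rewrite map_poly_eq0 monic_neq0 ?chi_monic.
- move=> i; rewrite (invariants_G2 k2 hK xiP) coef_map.
  by exists (chi (pullback xi h))`_i => //; exact: chi_coef_inv.
rewrite -{2}[h](pullback_xiK k2 hK xiP) /root horner_map fmorph_eq0.
exact: chi_root.
Qed.

Definition plane_map : 'I_3 -> K := tnth [tuple 1; beta; z].

Lemma linear_formE (w : 'I_3 -> k) :
  linear_form iota w plane_map = iota (w i0) + (iota (w i1) * beta + iota (w i2) * z).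
Proof. by rewrite /linear_form big_ord3 /plane_map !(tnth_nth 0) /= mulr1. Qed.

Lemma invariants_G1_sub (L : set K) : subextension iota L -> L z -> invariants G1 `<=` L.
Proof.
move=> sL Lz f /(invariant_G1 k2 hK)[p [r [_ ->]]].
have [LB LV kL] := (subextensionP _ _).1 sL.
have L0 : L 0 by rewrite -(rmorph0 iota).
have Lp (s : {poly k}) : L (map_poly iota s).[z].
  elim/poly_ind: s => [|s e IH]; first by rewrite rmorph0 horner0.
  rewrite rmorphD rmorphM /= map_polyX map_polyC hornerMXaddC.
  by apply: (subextensionD sL); [exact: (subextensionM sL)|exact: kL].
exact: (LV).
Qed.

Lemma z_invariant : invariants G1 z.
Proof. by move=> s [? [? []]]. Qed.

(** The linear forms through [(0 : 1 : 0)] are the combinations of [1] and [z]. *)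
Lemma projection_P1 :
  projection_field iota plane_map (tnth [tuple 0; 1; 0]) = invariants G1.
Proof.
have sG := invariants_subextension G1; have [LB LV kL] := (subextensionP _ _).1 sG.
apply/seteqP; split.
  apply: adjoin_min => // _ [w1 [w2 [+ + ->]]].
  rewrite !big_ord3 !(tnth_nth 0) /= !mulr0 !mulr1 !add0r !addr0 => w10 w20.
  have lin e (f := z) : invariants G1 (iota e * f).
    by apply: (subextensionM sG) => //; exact: z_invariant.
  rewrite !linear_formE w10 w20 rmorph0 mul0r !add0r.
  by apply: (LV); apply: (subextensionD sG).
apply: invariants_G1_sub; first exact: adjoin_subextension.
apply: adjoin_gen; exists (tnth [tuple 0; 0; 1]), (tnth [tuple 1; 0; 0]).
rewrite !linear_formE !big_ord3 !(tnth_nth 0) /= !rmorph0 !rmorph1.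
by split; [ring|ring|rewrite !mul0r !addr0 !add0r mul1r divr1].
Qed.

(** The linear forms through [(1 : 0 : 0)] are the combinations of [beta] and [z], that
    is [beta] times the images under [xi] of those of [1] and [z]. *)
Lemma projection_P2 :
  projection_field iota plane_map (tnth [tuple 1; 0; 0]) = invariants G2.
Proof.
have b0 := beta_neq0 k2 hK; have [px py pz] := xiP.
have sG := invariants_subextension G1; have [LB LV kL] := (subextensionP _ _).1 sG.
rewrite (invariants_G2 k2 hK xiP); apply/seteqP; split.
  have sG2 := invariants_subextension G2; rewrite (invariants_G2 k2 hK xiP) in sG2.
  apply: adjoin_min => // _ [w1 [w2 [+ + ->]]].
  rewrite !big_ord3 !(tnth_nth 0) /= !mulr0 !mulr1 !addr0 => w10 w20.
  have lin e : invariants G1 (iota e * z).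
    by apply: (subextensionM sG) => //; exact: z_invariant.
  exists ((iota (w1 i1) + iota (w1 i2) * z) / (iota (w2 i1) + iota (w2 i2) * z)).
    by apply: (LV); apply: (subextensionD sG).
  rewrite !linear_formE w10 w20 rmorph0 !add0r.
  rewrite fmorph_div !rmorphD !rmorphM /= !pullback_iota pz.
  have lb e e' : iota e * beta + iota e' * z = (iota e + iota e' * (z / beta)) * beta.
    by rewrite mulrDl -mulrA divfK.
  by rewrite !lb invfM mulrACA divff // mulr1.
have sA := adjoin_subextension iota [set h | exists w1 w2 : 'I_3 -> k,
    [/\ \sum_i w1 i * tnth [tuple 1; 0; 0] i = 0,
        \sum_i w2 i * tnth [tuple 1; 0; 0] i = 0
      & h = linear_form iota w1 plane_map / linear_form iota w2 plane_map]].
move=> _ [f fG <-].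
apply: (@invariants_G1_sub [set h | projection_field iota plane_map (tnth [tuple 1; 0; 0]) (pullback xi h)]) => //.
  have [AB AV kA] := (subextensionP _ _).1 sA.
  apply/subextensionP; split=> [h h' Ah Ah'|h h' Ah Ah'|e] /=.
  - by rewrite rmorphB; exact: AB.
  - by rewrite fmorph_div; exact: AV.
  - by rewrite pullback_iota; exact: kA.
apply: adjoin_gen; exists (tnth [tuple 0; 0; 1]), (tnth [tuple 0; 1; 0]).
rewrite !linear_formE !big_ord3 !(tnth_nth 0) /= !rmorph0 !rmorph1.
by split; [ring|ring|rewrite pz !mul0r !addr0 !add0r !mul1r].
Qed.

End PlaneModel.

Section PlaneCurve.
Context (n : nat) (k : closedFieldType) (k2 : 2%N \in [pchar k]).
Local Notation q0 := (2 ^ n)%N.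
Local Notation q := (2 * q0 ^ 2)%N.
Context (K : fieldType) (iota : {rmorphism k -> K}) (x y z : K).
Context (hK : is_function_field iota (affine_curve q0) (tnth [tuple x; y; z])).
Local Notation beta := (beta q0 x y).
Local Notation M := (q ^ 2)%N.
Local Notation chi := (chi k2 hK).
Local Notation g := (g1 k2 hK).
Context (xi : curve_aut iota) (xiP : is_xi q0 x y z xi).
Local Notation P1 := (P1 k2 hK xi).
Local Notation P2 := (P2 k2 hK).
Context (c : nat -> {poly k}).
Context (cE : forall i, (chi beta)`_i = (map_poly iota (c i)).[z]).
Local Notation F := (homogenization M.+1 c).
Local Notation f := (plane_map n x y z).

Let szi i : (0 < i)%N -> (size (c i) <= M.+1 - i)%N.
Proof. exact: (size_c xiP cE). Qed.
Let sz0 : (size (c 0) <= M.+2)%N.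
Proof. exact: (size_c0 xiP cE). Qed.

Lemma meval_ev3 (v : 'I_3 -> k) (p : {mpoly k[3]}) :
  p.@[v] = ev3 idfun (v i0) (v i1) (v i2) p.
Proof.
rewrite ev3_id; congr (_.@[_]); apply/funext => i.
by rewrite (tnth_nth 0); case: (ord3P i) => ->.
Qed.

Lemma F_plane_map : ev3 iota 1 beta z F = 0.
Proof.
rewrite ev3_homogenization //; under eq_bigr do rewrite -cE.
have := chi_root k2 hK beta; rewrite /root horner_coef size_chi.
by move/eqP.
Qed.

Lemma F_line0 (b w : k) : ev3 idfun 0 b w F = 0 -> w = 0.
Proof.
rewrite ev3_homogenization0 // => /eqP; rewrite mulf_eq0 expf_eq0 /=.
by rewrite (negPf (c0_lead xiP cE)) => /eqP.
Qed.

Lemma plane_map_P1 (v : 'I_3 -> k) : v i1 != 0 -> v i0 = 0 -> v i2 = 0 ->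
  maps_to f P1 v.
Proof.
move=> v1 v0 v2; have b0 := beta_neq0 k2 hK; split; first by exists i1.
have [vx vy vz] := P2_vanishes k2 hK; have [_ _ pz] := xiP.
have vb := P2_beta k2 hK.
have vbV : vanishes beta^-1 P1.
  by apply/(aut_vanishes xi _ P2); rewrite fmorphV /= (xi_beta k2 hK xiP) invrK.
have vzb : vanishes (z / beta) P1.
  apply/(aut_vanishes xi _ P2); rewrite fmorph_div /= (xi_beta k2 hK xiP) pz.
  by rewrite invrK divfK.
exists (iota (v i1) / beta); first by rewrite mulf_neq0 ?fmorph_eq0 ?invr_neq0.
move=> i; rewrite /plane_map (tnth_nth 0); case: (ord3P i) => -> /=.
- rewrite mulr1 v0; apply/value0; apply: vanishesMl => //; exact: regular_iota.
- by rewrite divfK //; exact: value_iota.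
- rewrite v2 -mulrA [_^-1 * _]mulrC; apply/value0; apply: vanishesMl => //.
  exact: regular_iota.
Qed.

(** Above an affine point of [F = 0] with last coordinate [w], the factorisation of
    the fibre [F(1, T, w)] provides a point of the curve with these values of
    [beta] and [z]. *)
Lemma point_above (b w : k) : ev3 idfun 1 b w F = 0 ->
  exists P : place iota, has_value beta P b /\ has_value z P w.
Proof.
have [a0 [b0 C]] := exists_on_curve n w.
have [v [vE vc]] := chi_at_point cE C.
have -> : ev3 idfun 1 b w F = (\prod_i ('X - (v i)%:P)).[b].
  have sz : size (\prod_i ('X - (v i)%:P)) = M.+1.
    by rewrite size_prod_XsubC /index_enum -enumT -cardE card_prod card_ord mulnn.
  rewrite ev3_homogenization // horner_coef sz.
  by apply: eq_bigr => i _; rewrite vc map_poly_id.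
rewrite horner_prod => /eqP; rewrite prodf_seq_eq0 => /hasP[i _] /=.
rewrite hornerXsubC subr_eq0 => /eqP bv.
exists (aut_act (g i) (affine_place k2 hK C)); split; apply/aut_value.
  by rewrite bv; exact: vE.
have [d [e [_ _ _ ->]]] := g1_in k2 hK i.
by have [] := affine_place_value k2 hK C.
Qed.

(** The points with [X <> 0] are covered by [point_above], and [(0 : 1 : 0)], the
    only other one, by [P1]. *)
Lemma plane_model : is_plane_model iota f F M.+1.
Proof.
have b0 := beta_neq0 k2 hK; have z0 := z_neq0 hK.
split.
- by exists i0; rewrite /plane_map (tnth_nth 0) oner_eq0.
- apply: (beta_z_generate k2 hK); first exact: adjoin_subextension.
    apply: adjoin_gen; exists i1, i0; rewrite /plane_map !(tnth_nth 0) /=.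
    by rewrite divr1.
  apply: adjoin_gen; exists i2, i0; rewrite /plane_map !(tnth_nth 0) /=.
  by rewrite divr1.
- apply: homogenization_irreducible => //; first exact: (c0_lead xiP cE).
  exact: (chi_beta_irreducible cE).
- exact: homogenization_homog.
move=> v [s vs]; rewrite meval_ev3; split; last first.
  move=> [P [_ [h h0 hv]]].
  have vF := value_mpoly F hv.
  apply: (value_uniq (f := 0) (P := P)); last exact/value0/vanishes0.
  rewrite -meval_ev3; congr has_value: vF.
  have -> : (fun i => h * f i) = tnth [tuple h * 1; h * beta; h * z].
    by apply/funext => i; rewrite /plane_map !(tnth_nth 0); case: (ord3P i) => ->.
  rewrite -[LHS]/(ev3 iota (h * 1) (h * beta) (h * z) F).
  by rewrite (ev3_homog _ _ _ _ _ (homogenization_homog _ _)) F_plane_map mulr0.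
have [v0|v0] := eqVneq (v i0) 0.
  rewrite v0 => /F_line0 v2; exists P1; apply: plane_map_P1 => //.
  by case: (ord3P s) vs => ->; rewrite ?v0 ?v2 ?eqxx.
move=> Fv; have [|P [Pb Pz]] := @point_above (v i1 / v i0) (v i2 / v i0).
  apply: (mulfI (expf_neq0 M.+1 v0)); rewrite mulr0 -[RHS]Fv.
  rewrite -(ev3_homog _ _ _ _ _ (homogenization_homog _ _)) mulr1.
  by rewrite ![v i0 * _]mulrC !divfK.
exists P; split; first by exists s.
exists (iota (v i0)); first by rewrite fmorph_eq0.
move=> i; rewrite /plane_map (tnth_nth 0); case: (ord3P i) => -> /=.
- by rewrite mulr1; exact: value_iota.
- rewrite -[v i1](divfK v0) [_ * v i0]mulrC; apply: valueM => //; exact: value_iota.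
- rewrite -[v i2](divfK v0) [_ * v i0]mulrC; apply: valueM => //; exact: value_iota.
Qed.

Lemma smooth_v1 : smooth_point F (tnth [tuple 0; 1; 0]).
Proof.
split.
- by exists i1; rewrite (tnth_nth 0) oner_eq0.
- rewrite meval_ev3 !(tnth_nth 0) /= ev3_homogenization0 //.
  by rewrite expr0n mulr0.
exists i0; rewrite mderiv0_homogenization //= (c_M cE) coef1.
exact: oner_neq0.
Qed.

Lemma smooth_v2 : smooth_point F (tnth [tuple 1; 0; 0]).
Proof.
have M1 := M_gt1 n; split.
- by exists i0; rewrite (tnth_nth 0) oner_eq0.
- have [_ _ _ _ FP] := plane_model; apply/FP; first by exists i0; rewrite (tnth_nth 0) oner_eq0.
  exists P2; split; first by exists i0; rewrite (tnth_nth 0) oner_eq0.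
  have [_ _ vz] := P2_vanishes k2 hK; have vb := P2_beta k2 hK.
  exists 1 => [|i]; first exact: oner_neq0.
  rewrite mul1r /plane_map !(tnth_nth 0).
  by case: (ord3P i) => -> /=; [exact: value1|exact/value0|exact/value0].
exists i1; rewrite mderiv1_homogenization; last exact: ltnW.
exact: (c1_0 cE).
Qed.

End PlaneCurve.

Theorem theorem3 (k : closedFieldType) (hk : 2%N \in [pchar k])
    (q0 : nat) (hq0 : exists n : nat, q0 = (2 ^ n)%N)
    (q : nat) (hq : q = (2 * q0 ^ 2)%N)
    (K : fieldType) (iota : {rmorphism k -> K}) (x y z : K)
    (hK : is_function_field iota (affine_curve q0) (tnth [tuple x; y; z])) :
  (exists (xi : curve_aut iota) (P1 : place iota),
    let P2 := aut_act xi P1 in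
    let G1 := group_G1 iota q0 x y z in
    let G2 := [set (xi * s * xi^-1)%g | s in G1] in
    [/\ is_xi q0 x y z xi,
        forall P : place iota, has_pole x P <-> P = P1,
        [/\ vanishes x P2, vanishes y P2 & vanishes z P2]
      & G1 #= `I_(q ^ 2)]
    /\
    [/\ quotient_is_P1 G1 /\ quotient_is_P1 G2,
        G1 `&` G2 = [set 1%g]
      & point_divisor P1 + \sum_(s \in G1) point_divisor (aut_act s P2)
        = point_divisor P2 + \sum_(t \in G2) point_divisor (aut_act t P1)])
  /\
  (exists (f : 'I_3 -> K) (F : {mpoly k[3]}),
    is_plane_model iota f F (q ^ 2 + 1)
    /\ exists v1 v2 : 'I_3 -> k,
      [/\ ~ same_point v1 v2, inner_galois_point iota f F v1
        & inner_galois_point iota f F v2]).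
Proof.
have [n q0E] := hq0; subst q0 q; have [xi xiP] := xi_exists hk hK.
split.
  exists xi, (P1 hk hK xi); rewrite /= (xi_P1 hk hK xiP); split.
    split=> //; [exact: pole_x|exact: (P2_vanishes hk hK)|exact: (card_G1 hk hK)].
  split; [split|exact: G1_G2_trivial|exact: divisor_eq].
    exact: quotient_G1.
  exact: quotient_G2.
have [c] := chi_coefE hk hK (beta_poly n k); rewrite ev3_beta => cE.
exists (plane_map n x y z), (homogenization ((2 * (2 ^ n) ^ 2) ^ 2).+1 c).
rewrite (addn1 (_ ^ 2)); split; first exact: (plane_model xiP cE).
exists (tnth [tuple 0; 1; 0]), (tnth [tuple 1; 0; 0]); split.
- move=> [e _ /(_ i0)]; rewrite !(tnth_nth 0) /= mulr0 => /eqP.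
  by rewrite oner_eq0.
- split; first exact: (smooth_v1 xiP cE).
  by rewrite projection_P1 //; exact: is_galois_G1.
- split; first exact: (smooth_v2 xiP cE).
  by rewrite (projection_P2 hk hK xiP); exact: is_galois_G2.
Qed.
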